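(* Let $G$ be a countable, finitely generated amenable group and let $A$ be a finite set. For all but a countable set of values of $c$, the space $\mathfrak{S}_{\ge c}$ of shifts in $A^G$ with entropy at least $c$ has no isolated points, and is therefore homeomorphic to the Cantor space.
   Context: $A^G$ carries the product topology ($A$ discrete), and $G$ acts on it by $[gx](h)=x(g^{-1}h)$. A shift is a closed $G$-invariant subset $X\subseteq A^G$. For finite $K\subset G$, $x_K$ is the restriction of $x$ to $K$ and $X_K=\{x_K : x\in X\}$. The space $\mathfrak{S}$ of all shifts in $A^G$ has the Hausdorff topology, which is compact and Polish; $X^n\to X$ if and only if for every finite $K\subset G$ one has $X^n_K=X_K$ for all large enough $n$. Fix a left-invariant word metric $d$ on $G$, and let $B_r=\{g\in G: d(e,g)\le r\}$. For finite $F\subset G$ let $\partial_rF=\{g\in G: gB_r\cap F\ne\emptyset \text{ and } gB_r\cap(G\setminus F)\neq\emptyset\}$ and $\rho_r(F)=|\partial_rF|/|F|$. A sequence $(F_n)$ of finite subsets of $G$ is Følner if $\lim_n\rho_r(F_n)=0$ for every $r\in\mathbb{N}$. The entropy of a shift $X$ is $h(X)=\lim_{n\to\infty}\frac{1}{|F_n|}\log|X_{F_n}|$ for any Følner sequence $(F_n)$ (the limit exists and does not depend on the sequence). For $c\ge 0$, $\mathfrak{S}_{\ge c}=\{X\in\mathfrak{S}: h(X)\ge c\}$ with the subspace topology.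
   Formalization: G is assumed infinite (for finite G and |A| ≥ 2 the space is finite and discrete, so the claim fails), and homeomorphism to the Cantor space is claimed only for c ≤ log|A| (for larger c the space of shifts with entropy at least c is empty). *)

(* Defs.v *)
From HB Require Import structures.
From mathcomp Require Import all_boot all_order all_algebra finmap.
From mathcomp Require Import all_classical all_reals all_analysis.

Set Implicit Arguments.
Unset Strict Implicit.
Unset Printing Implicit Defensive.

Import Order.TTheory GRing.Theory Num.Theory numFieldNormedType.Exports.
Local Open Scope classical_set_scope.
Local Open Scope ring_scope.

Definition homeomorphic (T U : topologicalType) : Prop :=
  exists f : T -> U, exists g : U -> T,
    [/\ cancel f g, cancel g f, continuous f & continuous g].

(** * The Hausdorff uniformity on the subsets of a uniform space *)

(* Restricted to the closed subsets of a compact space, this induces the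
   usual Hausdorff topology. *)
Definition hyperspace (U : Type) : Type := set U.

Section hyperspace_uniform.
Local Open Scope relation_scope.
Variable U : uniformType.

HB.instance Definition _ := Choice.copy (hyperspace U) (set U).

Definition hausdorff_near (E : set (U * U)) :
    set (hyperspace U * hyperspace U) :=
  [set XY | (forall x, XY.1 x -> exists2 y, XY.2 y & E (x, y)) /\
            (forall y, XY.2 y -> exists2 x, XY.1 x & E (x, y))].

Definition hausdorff_ent : set_system (hyperspace U * hyperspace U) :=
  filter_from (@entourage U) hausdorff_near.

Lemma hausdorff_nearS E F : E `<=` F -> hausdorff_near E `<=` hausdorff_near F.
Proof.
move=> EF [X Y] [/= h1 h2]; split => /= z /[dup] Zz.
  by move=> /h1[y Yy /EF]; exists y.
by move=> /h2[x Xx /EF]; exists x.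
Qed.

Let hausdorff_ent_filter : Filter hausdorff_ent.
Proof.
apply: filter_from_filter; first by exists setT; exact: entourageT.
move=> P Q Pe Qe; exists (P `&` Q); first exact: filterI.
by move=> XY h; split; apply: hausdorff_nearS h => ? [].
Qed.

Let hausdorff_ent_refl A : hausdorff_ent A -> diagonal `<=` A.
Proof.
move=> [E entE sEA] [X Y] /diagonalP ->; apply: sEA.
by split=> x /= Yx; exists x => //; exact: entourage_refl.
Qed.

Let hausdorff_ent_inv A : hausdorff_ent A -> hausdorff_ent A^-1.
Proof.
move=> [E entE sEA]; exists E^-1; first exact: entourage_inv.
by move=> [X Y] [/= h1 h2]; apply: sEA; split.
Qed.

Let hausdorff_ent_split A : hausdorff_ent A ->
  exists2 B, hausdorff_ent B & B \; B `<=` A.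
Proof.
move=> [E entE sEA]; have [C [entC CE]] :
  exists C, entourage C /\ C \; C `<=` E by exact/exists2P/entourage_split_ex.
exists (hausdorff_near C); first by exists C.
move=> [X Z] [Y [/= XY1 XY2] [/= YZ1 YZ2]]; apply: sEA; split=> /= z.
  by move=> /XY1[y /YZ1[w Zw yw] zy]; exists w => //; apply: CE; exists y.
by move=> /YZ2[y /XY2[x Xx xy] yz]; exists x => //; apply: CE; exists y.
Qed.

HB.instance Definition _ := isUniform.Build (hyperspace U)
  hausdorff_ent_filter hausdorff_ent_refl hausdorff_ent_inv
  hausdorff_ent_split.

End hyperspace_uniform.

(** * Word metrics, Folner sequences *)

Section word_metric.
Local Open Scope group_scope.
Variables (G : groupType) (S : {fset G}).

Definition represents (w : seq G) (g : G) : Prop :=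
  all (fun s => (s \in S) || (s^-1 \in S)) w /\ \prod_(s <- w) s = g.

Definition generates : Prop := forall g, exists w, represents w g.

(* The value 0 for elements outside the subgroup generated by S is never met
   when S generates G. *)
Definition word_norm (g : G) : nat :=
  if pselect (exists n, `[< exists2 w, represents w g & size w = n >])
    is left e then ex_minn e else 0.

Definition word_dist (g h : G) : nat := word_norm (g^-1 * h).

Definition word_ball (r : nat) : set G := [set g | (word_dist 1 g <= r)%N].

Definition boundary (r : nat) (F : {fset G}) : set G :=
  [set g | ([set g * b | b in word_ball r] `&` [set` F]) !=set0 /\
           ([set g * b | b in word_ball r] `&` ~` [set` F]) !=set0].

Definition rho (R : realType) (r : nat) (F : {fset G}) : R :=
  (#|` fset_set (boundary r F)|%:R / #|` F|%:R)%R.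

(* rho is only meaningful on nonempty sets: without the first clause the
   constant sequence fset0 would qualify, as division by 0 yields 0. *)
Definition Folner (R : realType) (F : nat -> {fset G}) : Prop :=
  (forall n, F n != fset0) /\
  forall r : nat, rho R r (F n) @[n --> \oo] --> (0%R : R).

Definition amenable (R : realType) : Prop := exists F, Folner R F.

End word_metric.

(** * Shifts *)

Section shifts.
Variables (G : groupType) (A : finType).

Definition configuration : Type := {ptws G -> discrete_topology A}.

HB.instance Definition _ := Uniform.on configuration.

Definition shift_act (g : G) (x : configuration) : configuration :=
  fun h => x (g^-1 * h)%g.

Definition is_shift (X : set configuration) : Prop :=
  closed X /\ forall g x, X x -> X (shift_act g x).

Definition shift_space : Type :=
  set_type [set X : hyperspace configuration | is_shift X].

HB.instance Definition _ := Uniform.on shift_space.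

Definition restrict (K : {fset G}) (x : configuration) : {ffun K -> A} :=
  [ffun k : K => x (val k)].

Definition patterns (K : {fset G}) (X : set configuration) :
    {set {ffun K -> A}} :=
  finset (fun p => `[< (restrict K @` X) p >]).

(* Extended-real valued, so that the empty shift has entropy -oo. *)
Definition entropy_along (R : realType) (F : nat -> {fset G})
    (X : set configuration) (n : nat) : \bar R :=
  ((#|` F n|%:R^-1)%:E * lne (#|patterns (F n) X|%:R)%:E)%E.

Definition entropy (R : realType) (S : {fset G}) (X : set configuration) :
    \bar R :=
  xget -oo%E [set h | forall F : nat -> {fset G}, Folner S R F ->
                        entropy_along R F X n @[n --> \oo] --> h].

Definition entropy_ge (R : realType) (S : {fset G}) (c : R) :
    set shift_space :=
  [set X | (c%:E <= entropy R S (set_val X))%E].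

End shifts.

Arguments entropy_ge {G} A {R} S c.

(** * Sanity checks *)

Section word_metric_facts.
Variables (G : groupType) (S : {fset G}).
Hypothesis S_generates : generates S.

Lemma word_normP g : exists2 w, represents S w g & size w = word_norm S g.
Proof.
rewrite /word_norm; case: pselect => [e|[]].
  by case: ex_minnP => n /asboolP.
by have [w wg] := S_generates g; exists (size w); apply/asboolP; exists w.
Qed.

Lemma finite_word_ball r : finite_set (word_ball S r).
Proof.
pose gens := [seq s <- S | true] ++ [seq (s^-1)%g | s <- S].
pose words := flatten [seq [seq val t | t in {: n.-tuple (seq_sub gens)}]
                       | n <- iota 0 r.+1].
pose prods := [seq (\prod_(s <- w) val (s : seq_sub gens))%g | w <- words].
apply: (@sub_finite_set _ _ [set` prods]); last exact: finite_seq.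
move=> g; rewrite /word_ball/= /word_dist invg1 mul1g.
have [w [wS <-] <-] := word_normP g => wr.
have wg s : s \in w -> s \in gens.
  move=> /(allP wS); rewrite /gens mem_cat filter_predT => /orP[->//|sS].
  by apply/orP; right; apply/mapP; exists s^-1%g; rewrite ?invgK.
have [t tw] : exists t : seq (seq_sub gens), map val t = w.
  elim: w {wS wr} wg => [|s w IH] wg; first by exists [::].
  have [|t tw] := IH; first by move=> u uw; apply: wg; rewrite inE uw orbT.
  by exists (SeqSub (wg s (mem_head _ _)) :: t); rewrite /= tw.
apply/mapP; exists t; last by rewrite -tw big_map.
apply/flattenP; exists [seq val u | u in {: (size t).-tuple (seq_sub gens)}].
  apply/mapP; exists (size t) => //.
  by rewrite mem_iota add0n leq0n/= ltnS -(size_map val t) tw.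
by apply/mapP; exists (in_tuple t); rewrite ?mem_enum.
Qed.

Lemma finite_boundary r F : finite_set (boundary S r F).
Proof.
apply: (@sub_finite_set _ _
  ((fun fb : G * G => (fb.1 * fb.2^-1)%g) @` ([set` F] `*` word_ball S r))).
  move=> g [[_ [[b rb <-] gbF]] _]; exists (g * b, b)%g => //=.
  by rewrite mulgK.
by apply: finite_image; apply: finite_setX => //; exact: finite_word_ball.
Qed.

End word_metric_facts.

Section shift_space_topology.
Variables (G : groupType) (A : finType).
Local Notation cfg := (configuration G A).

Lemma configuration_entourageP (E : set (cfg * cfg)) : entourage E <->
  exists K : {fset G},
    [set xy | restrict K xy.1 = restrict K xy.2] `<=` E.
Proof.
have restrictP (K : {fset G}) (x y : cfg) :
    restrict K x = restrict K y <-> forall k, k \in K -> x k = y k.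
  split=> [/ffunP xy k kK|xy].
    by have := xy [` kK]%fset; rewrite !ffunE.
  by apply/ffunP => k; rewrite !ffunE; apply: xy; exact: (valP k).
split.
  move=> [_ [F _ <-] FE].
  pose K : set G := (fun p => (projT1 p).1) @` [set` F].
  have Kfin : finite_set K by exact: finite_image.
  exists (fset_set K) => -[x y] /= /restrictP xy.
  apply: FE => p /= pF; have := projT2 p; move: (pF).
  case: p pF => -[i W] /= Wi pF _ _.
  move/asboolP: (Wi) => [V Vent VW]; apply: VW.
  have xyi : x i = y i.
    by apply: xy; rewrite in_fset_set// inE; exists (exist _ (i, W) Wi).
  suff: V (x i, y i) by [].
  by rewrite xyi; exact: entourage_refl.
move=> [K KE]; apply: (filterS KE).
have kE (k : G) : entourage [set xy : cfg * cfg | xy.1 k = xy.2 k].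
  have Wk : `[< @entourage (initial_topology (@proj _ (fun=> discrete_topology A) k))
      [set xy : cfg * cfg | xy.1 k = xy.2 k] >].
    apply/asboolP; exists diagonal => //; rewrite uniform_discrete.
    by move=> _ [a _ <-].
  exists [set xy : cfg * cfg | xy.1 k = xy.2 k] => //.
  match goal with |- finI_from ?D ?f _ =>
    exact: (@finI_from1 _ _ D f (exist _ (k, _) Wk)) end.
have -> : [set xy : cfg * cfg | restrict K xy.1 = restrict K xy.2] =
    \bigcap_(k in [set` K]) [set xy : cfg * cfg | xy.1 k = xy.2 k].
  by apply/seteqP; split=> -[x y] /= /restrictP.
exact: filter_bigI.
Qed.

Lemma nbhs_shiftP (X : shift_space G A) (P : set (shift_space G A)) :
  nbhs X P <-> exists K : {fset G}, [set Y : shift_space G A |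
    patterns K (set_val Y) = patterns K (set_val X)] `<=` P.
Proof.
have patternsE (K : {fset G}) (Y Z : set cfg) : patterns K Y = patterns K Z <->
    hausdorff_near [set xy | restrict K xy.1 = restrict K xy.2] (Y, Z).
  split=> [/setP YZ|[/= h1 h2]].
    split=> /= x hx; have := YZ (restrict K x); rewrite !inE.
      by rewrite (_ : `[< _ >]); [move=> /esym/asboolP[y]; exists y|
        apply/asboolP; exists x].
    rewrite [in RHS](_ : `[< _ >]); [|by apply/asboolP; exists x].
    by move=> /asboolP[y]; exists y.
  apply/setP => p; rewrite !inE; apply: asbool_equiv_eq; split.
    by move=> [x /h1[y Zy/= xy] <-]; exists y.
  by move=> [x /h2[y Zy/= xy] <-]; exists y.
rewrite -nbhs_entourageE; split.
  move=> [W [V [E /configuration_entourageP[K KE] EV] VW] WP].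
  exists K => Y /= YX; apply: WP; apply/mem_set; apply: VW; apply: EV => /=.
  by apply: (hausdorff_nearS KE); apply/patternsE.
move=> [K KP].
exists [set XY : shift_space G A * shift_space G A |
  patterns K (set_val XY.1) = patterns K (set_val XY.2)]; last first.
  by move=> Y /xsectionP/= XY; apply: KP.
exists (hausdorff_near [set xy | restrict K xy.1 = restrict K xy.2]).
  exists [set xy | restrict K xy.1 = restrict K xy.2] => //.
  by apply/configuration_entourageP; exists K.
by move=> [Y Z] /patternsE.
Qed.

Lemma cvg_shiftP (X : nat -> shift_space G A) (Y : shift_space G A) :
  X n @[n --> \oo] --> Y <-> forall K : {fset G},
    \forall n \near \oo, patterns K (set_val (X n)) = patterns K (set_val Y).
Proof.
split=> [XY K|XY P /nbhs_shiftP[K KP]].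
  apply: (XY [set Z : shift_space G A |
    patterns K (set_val Z) = patterns K (set_val Y)]).
  by apply/nbhs_shiftP; exists K.
by apply: filterS (XY K) => n /KP.
Qed.

End shift_space_topology.

(* Main.v *)
(* By Shearer's inequality the entropy of a nonempty shift X is the infimum of
   log |X_K| / |K| over the finite nonempty sets K.  Hence the condition
   h(X) >= c is closed, and it is preserved by passing to a larger shift.  If X
   is isolated in the shifts of entropy at least c, its finite type
   approximations, which contain X, must therefore coincide with X.  There are
   only countably many shifts of finite type; taking D to consist of 0 and of
   their entropies, we may assume h(X) > c > 0.

   On a large Folner set F, the patterns of X vastly outnumber the contents of
   the boundary of F, so some pattern q of X on F can be exchanged, at any
   place, for at least N other patterns with the same boundary, where N exceeds
   any given multiple of |F|^2.  Resampling then shows that q occurs at a given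
   place with conditional probability at most 1/N, and a counting form of the
   Lovasz local lemma bounds below by (1 - 2/N)^|E| the proportion of patterns
   on E that avoid q.  Thus the points of X avoiding q form a proper subshift
   with the same small patterns and an entropy at least h(X) + log(1 - 2/N),
   which is at least c: X was not isolated. *)

Require Import Defs.
From HB Require Import structures.
From mathcomp Require Import all_boot all_order all_algebra finmap.
From mathcomp Require Import all_classical all_reals all_analysis.
From mathcomp Require Import ring lra.

Set Implicit Arguments.
Unset Strict Implicit.
Unset Printing Implicit Defensive.

Import Order.TTheory GRing.Theory Num.Theory numFieldNormedType.Exports.
Local Open Scope classical_set_scope.
Local Open Scope ring_scope.

Local Notation restrict := Defs.restrict.

(** * Counting patterns *)

(** A form of Hölder's inequality for integer counts. Dividing [u i] by [U i] gives weights in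
    [0, 1]; by AM-GM their product over [J] is at most the [k]-th power of their mean [s a], and
    these means sum to at most 1. *)
Lemma holder_card (A I : finType) (J : {set I}) (k : nat) (n : A -> nat)
    (u : I -> A -> nat) (U : I -> nat) :
    (0 < k <= #|J|)%N ->
    (forall i, i \in J -> (\sum_a u i a <= U i)%N) ->
    (forall i a, (u i a <= U i)%N) ->
    (forall a, (n a ^ k <= \prod_i u i a)%N) ->
  ((\sum_a n a) ^ k <= \prod_i U i)%N.
Proof.
move=> /andP[k0 kJ] uJ uU nu.
have J0 : (0 < #|J|)%N by exact: leq_trans kJ.
have [/existsP[i /eqP Ui]|/existsPn U0] := boolP [exists i, U i == 0%N].
  suff -> : (\sum_a n a = 0)%N by rewrite exp0n.
  apply: big1 => a _; apply/eqP; rewrite -leqn0 -(leq_exp2r _ _ k0) exp0n//.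
  apply: leq_trans (nu a) _.
  rewrite (bigD1 i)//= (_ : u i a = 0%N) ?mul0n//.
  by apply/eqP; rewrite -leqn0 -Ui.
have UQ i : 0 < (U i)%:R :> rat by rewrite ltr0n lt0n U0.
pose w i a : rat := (u i a)%:R / (U i)%:R.
have w0 i a : 0 <= w i a by rewrite divr_ge0// ler0n.
have w1 i a : w i a <= 1 by rewrite ler_pdivrMr// mul1r ler_nat.
pose s a := (\sum_(i in J) w i a) / #|J|%:R.
have s0 a : 0 <= s a by rewrite divr_ge0// ?ler0n// sumr_ge0.
have s1 a : s a <= 1.
  rewrite ler_pdivrMr ?ltr0n// mul1r.
  rewrite -sum1_card natr_sum; apply: ler_sum => i _; exact: w1.
have ss1 : \sum_a s a <= 1.
  rewrite -mulr_suml ler_pdivrMr ?ltr0n// mul1r exchange_big/=.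
  rewrite -sum1_card natr_sum; apply: ler_sum => i iJ.
  rewrite -mulr_suml ler_pdivrMr// mul1r -natr_sum ler_nat; exact: uJ.
set C := (\prod_i U i)%N.
have C0 : 0 < C%:R :> rat by rewrite natr_prod prodr_gt0.
have nC a : (n a ^ k)%:R <= C%:R * s a ^+ k.
  apply: le_trans (_ : (\prod_i u i a)%:R <= _); first by rewrite ler_nat.
  have -> : (\prod_i u i a)%:R = C%:R * \prod_i w i a.
    rewrite !natr_prod -big_split/=; apply: eq_bigr => i _.
    by rewrite mulrC divfK// gt_eqF.
  rewrite ler_pM2l//.
  apply: le_trans (_ : \prod_(i in J) w i a <= _).
    rewrite [leLHS](bigID [in J])/= ler_piMr// ?prodr_ge0//.
    by apply: prodr_ile1 => i _; rewrite w0 w1.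
  have [agm _] := leif_AGM (fun i (_ : i \in J) => w0 i a).
  apply: le_trans agm _. exact: (ler_wiXn2l (s0 a) (s1 a) kJ).
set t := (\sum_a n a)%N.
have [->|t0] := posnP t; first by rewrite exp0n.
(* Some [a] carries at least its share [s a] of the total, which makes the k-th
   roots of Hoelder's inequality unnecessary. *)
have [a na ta] : exists2 a, (0 < n a)%N & t%:R * s a <= (n a)%:R.
  apply: contrapT => h.
  have lt a : (0 < n a)%N -> (n a)%:R < t%:R * s a.
    by move=> na; rewrite ltNge; apply/negP => ?; apply: h; exists a.
  have le a : (n a)%:R <= t%:R * s a.
    have [->|/lt/ltW//] := posnP (n a).
    by rewrite mulr_ge0.
  have [a na] : exists a, (0 < n a)%N.
    apply: contrapT => h'; move: t0; rewrite /t big1// => a _.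
    by have [//|na] := posnP (n a); exfalso; apply: h'; exists a.
  have : \sum_b (n b)%:R < \sum_b t%:R * s b :> rat.
    by rewrite (bigD1 a)//= [ltRHS](bigD1 a)//= ltr_leD ?lt// ler_sum.
  by rewrite -natr_sum -mulr_sumr ltNge ler_piMr.
have sa : 0 < s a.
  rewrite lt_neqAle s0 andbT; apply: contraTneq (nC a) => <-.
  by rewrite expr0n (gtn_eqF k0) mulr0 -ltNge ltr0n expn_gt0 na.
rewrite -(ler_nat rat) natrX -(ler_pM2r (exprn_gt0 k sa)) -exprMn.
apply: le_trans (nC a); rewrite natrX lerXn2r// nnegrE ?ler0n//.
by rewrite mulr_ge0// ler0n.
Qed.

Section pattern_counts.
Variables (G : groupType) (A : finType).
Local Notation cfg := (configuration G A).
Implicit Types (K E F : {fset G}) (X Z : set cfg) (x y : cfg) (g h : G).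

Definition npat K Z : nat := #|patterns K Z|.

Lemma restrictP K x y : restrict K x = restrict K y <->
  forall k, k \in K -> x k = y k.
Proof.
split=> [/ffunP xy k kK|xy]; first by have := xy [` kK]%fset; rewrite !ffunE.
by apply/ffunP => k; rewrite !ffunE; apply: xy; exact: (valP k).
Qed.

Lemma patternsP K Z p : reflect (exists2 x, Z x & restrict K x = p)
  (p \in patterns K Z).
Proof. by rewrite inE; exact: asboolP. Qed.

Lemma mem_patterns K Z x : Z x -> restrict K x \in patterns K Z.
Proof. by move=> Zx; apply/patternsP; exists x. Qed.

(** Counts a gluing construction: [f] acts on configurations and need only be injective on patterns,
    each pattern being represented by a chosen point of its set. *)
Lemma npat_mul K1 Z1 K2 Z2 K Z (f : cfg -> cfg -> cfg) :
    (forall x y, Z1 x -> Z2 y -> Z (f x y)) ->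
    (forall x y x' y', Z1 x -> Z2 y -> Z1 x' -> Z2 y' ->
      restrict K (f x y) = restrict K (f x' y') ->
      restrict K1 x = restrict K1 x' /\ restrict K2 y = restrict K2 y') ->
  (npat K1 Z1 * npat K2 Z2 <= npat K Z)%N.
Proof.
move=> Zf fI; rewrite /npat -cardsX.
have [->|/set0Pn[[p0 q0]]] :=
  eqVneq (finset.setX (patterns K1 Z1) (patterns K2 Z2)) finset.set0.
  by rewrite cards0.
rewrite finset.in_setX => /= /andP[/patternsP[x0 _ _] _].
pose rep K' Z' p := xget x0 [set x | Z' x /\ restrict K' x = p].
have repP K' Z' p : p \in patterns K' Z' ->
    Z' (rep K' Z' p) /\ restrict K' (rep K' Z' p) = p.
  rewrite /rep => /patternsP[x Z'x xp].
  by case: xgetP => [y _ //|] /(_ x); case.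
pose F pq := restrict K (f (rep K1 Z1 pq.1) (rep K2 Z2 pq.2)).
rewrite -(card_in_imset (f := F)); last first.
  move=> [p q] [p' q'] /=; rewrite !finset.in_setX/=.
  move=> /andP[/repP[a1 a2] /repP[b1 b2]] /andP[/repP[c1 c2] /repP[d1 d2]].
  move=> /(fI _ _ _ _ a1 b1 c1 d1); rewrite a2 b2 c2 d2.
  by case=> -> ->.
apply: subset_leq_card; apply/fintype.subsetP => _ /imsetP[[p q] + ->].
rewrite finset.in_setX/= => /andP[/repP[a1 a2] /repP[b1 b2]].
by apply: mem_patterns; exact: Zf.
Qed.

Lemma npat_gt0 K Z : (0 < npat K Z)%N <-> Z !=set0.
Proof.
split=> [/card_gt0P[p /patternsP[x Zx _]]|[x Zx]]; first by exists x.
by apply/card_gt0P; exists (restrict K x); exact: mem_patterns.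
Qed.

Lemma npat_le K1 Z1 K Z (f : cfg -> cfg) :
    (forall x, Z1 x -> Z (f x)) ->
    (forall x x', Z1 x -> Z1 x' ->
      restrict K (f x) = restrict K (f x') -> restrict K1 x = restrict K1 x') ->
  (npat K1 Z1 <= npat K Z)%N.
Proof.
move=> Zf fI; have [->//|/npat_gt0 Z10] := posnP (npat K1 Z1).
(* The second factor lives on the empty window, where a nonempty set has a pattern. *)
rewrite -[leqLHS]muln1; apply: leq_trans (_ : npat K1 Z1 * npat fset0 Z1 <= _)%N.
  by rewrite leq_mul2l; apply/orP; right; exact/npat_gt0.
apply: (npat_mul (f := fun x _ => f x)); first by move=> *; exact: Zf.
move=> x y x' y' Zx _ Zx' _ e; split; first exact: fI e.
by apply/restrictP.
Qed.

Lemma npatS K K' Z Z' : {subset K <= K'} -> Z `<=` Z' ->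
  (npat K Z <= npat K' Z')%N.
Proof.
move=> KK' ZZ'; apply: (npat_le (f := id)); first exact: ZZ'.
by move=> x x' _ _ /restrictP h; apply/restrictP => k /KK' /h.
Qed.

Lemma npat_max K Z : (npat K Z <= #|A| ^ #|` K|)%N.
Proof. by rewrite cardfE -card_ffun; exact: max_card. Qed.

Lemma npat_fibers E h Z : h \in E ->
  npat E Z = (\sum_a npat E [set x | Z x /\ x h = a])%N.
Proof.
move=> hE; rewrite /npat -sum1_card.
rewrite (partition_big (fun p : {ffun E -> A} => p [` hE]%fset) predT)//=.
apply: eq_bigr => a _; rewrite -sum1_card; apply: eq_bigl => p.
apply/andP/patternsP => [[/patternsP[x Zx xp] /eqP pa]|[x [Zx xa] <-]].
  by exists x => //; split=> //; rewrite -pa -xp ffunE.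
by split; [exact: mem_patterns|rewrite ffunE/= xa].
Qed.

(** Shearer's inequality as a count, by induction on [F]: the symbol at a site [h] splits the
    patterns into classes, the induction hypothesis bounds each class on the other sites, and
    Hölder's inequality over the sets [E i] containing [h] adds them up. *)
Lemma shearer (I : finType) (E : I -> {fset G}) (k : nat) F Z : (0 < k)%N ->
    (forall h, h \in F -> (k <= #|[set i | h \in E i]%SET|)%N) ->
  (npat F Z ^ k <= \prod_i npat (E i) Z)%N.
Proof.
move=> k0; elim/finSet_rect: F Z => F IH Z cov.
have [->|/npat_gt0 Z0] := posnP (npat F Z); first by rewrite exp0n.
have [F0|[h hF]] := fset_0Vmem F.
  apply: leq_trans (_ : 1 <= _)%N.
    rewrite -[leqRHS](exp1n k) leq_exp2r// (leq_trans (npat_max _ _))//.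
    by rewrite F0 cardfs0.
  by apply: prodn_gt0 => i; apply/npat_gt0.
rewrite (npat_fibers _ hF).
apply: (@holder_card _ _ [set i | h \in E i]%SET _ _
  (fun i a => npat (E i) [set x | Z x /\ x h = a])).
- by rewrite k0 cov.
- by move=> i; rewrite inE => hEi; rewrite -npat_fibers.
- by move=> i a; apply: npatS => // x [].
move=> a; apply: leq_trans (IH (F `\ h)%fset _ _ _); last 2 first.
- exact: fproperD1.
- by move=> j; rewrite in_fsetD1 => /andP[_ /cov].
rewrite leq_exp2r//; apply: (npat_le (f := id)) => // x x' [_ xa] [_ x'a].
move=> /restrictP xx'; apply/restrictP => j jF.
have [->|jh] := eqVneq j h; first by rewrite xa x'a.
by apply: xx'; rewrite in_fsetD1 jh.
Qed.

Lemma npat_classes F K Z (M : nat) :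
    (forall x, Z x ->
      (npat F [set y | Z y /\ restrict K y = restrict K x] <= M)%N) ->
  (npat F Z <= npat K Z * M)%N.
Proof.
move=> ZM; have [->//|/npat_gt0[x0 _]] := posnP (npat F Z).
pose rep p := xget x0 [set x | Z x /\ restrict F x = p].
have repP p : p \in patterns F Z -> Z (rep p) /\ restrict F (rep p) = p.
  rewrite /rep => /patternsP[x Zx xp].
  by case: xgetP => [y _ //|] /(_ x); case.
rewrite {1}/npat -sum1_card.
rewrite (partition_big (fun p => restrict K (rep p)) [in patterns K Z])/=;
  last first.
  by move=> p /repP[Zp _]; exact: mem_patterns.
rewrite /npat -sum_nat_const; apply: leq_sum => _ /patternsP[x Zx <-].
apply: leq_trans (ZM x Zx); rewrite sum1_card.
apply: subset_leq_card; apply/fintype.subsetP => p.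
rewrite inE => /andP[/repP[Zp pE] /eqP pK].
by apply/asboolP; exists (rep p).
Qed.

End pattern_counts.

(** * Entropy as an infimum *)

Section folner.
Variables (G : groupType) (A : finType) (S : {fset G}).
Hypothesis S_generates : generates S.
Local Notation cfg := (configuration G A).
Implicit Types (K E F : {fset G}) (X Z : set cfg) (x y : cfg) (g h : G).

Definition boundary_fset (r : nat) F : {fset G} := fset_set (boundary S r F).

Definition translate g K : {fset G} := [fset (g * k)%g | k in K]%fset.

Lemma in_translate g K h : (h \in translate g K) = ((g^-1 * h)%g \in K).
Proof.
apply/imfsetP/idP => [[k /= kK ->]|gh]; first by rewrite mulKg.
by exists (g^-1 * h)%g; rewrite //= mulVKg.
Qed.

Lemma card_translate g K : #|` translate g K| = #|` K|.
Proof. by apply: card_imfset; exact: mulgI. Qed.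

Lemma npat_translate g K Z Z' :
  (forall x, Z x -> Z' (shift_act g^-1 x)) ->
  (npat (translate g K) Z <= npat K Z')%N.
Proof.
move=> ZZ'; apply: (npat_le (f := shift_act g^-1)); first exact: ZZ'.
move=> x x' _ _ /restrictP e; apply/restrictP => k; rewrite in_translate => /e.
by rewrite /shift_act invgK mulVKg.
Qed.

Lemma in_boundary_fset r F g : reflect
  ((exists2 b, word_ball S r b & (g * b)%g \in F) /\
   (exists2 b, word_ball S r b & (g * b)%g \notin F)) (g \in boundary_fset r F).
Proof.
rewrite /boundary_fset in_fset_set ?inE; last exact: finite_boundary.
apply: (iffP idP) => [/set_mem[[_ [[b rb <-] bF]] [_ [[b' rb' <-] b'F]]]|].
  by split; [exists b | exists b' => //; apply/negP].
move=> [[b rb bF] [b' rb' b'F]]; apply/mem_set; split.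
  by exists (g * b)%g; split => //; exists b.
by exists (g * b')%g; split; [exists b'|apply/negP].
Qed.

Lemma word_norm_le w g : represents S w g -> (word_norm S g <= size w)%N.
Proof.
move=> wg; rewrite /word_norm; case: pselect => // e.
by case: ex_minnP => n _; apply; apply/asboolP; exists w.
Qed.

Lemma word_ball1 r : word_ball S r 1%g.
Proof.
rewrite /word_ball/= /word_dist invg1 mul1g.
apply: leq_trans (leq0n r); apply: (@word_norm_le [::]).
by split => //; rewrite big_nil.
Qed.

Lemma sub_word_ball K : exists r, forall k, k \in K -> word_ball S r k.
Proof.
exists (\max_(k : K) word_dist S 1 (val k))%N => k kK.
rewrite /word_ball/=.
exact: (@leq_bigmax _ (fun k : K => word_dist S 1 (val k)) (FSetSub kK)).
Qed.

Lemma leq_card_fset (T : choiceType) (P B : {fset T}) (Q : pred P) :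
  (forall i, Q i -> val i \in B) -> (#|Q| <= #|` B|)%N.
Proof.
move=> QB; rewrite cardE -(size_map val); apply: uniq_leq_size.
  by rewrite map_inj_uniq ?enum_uniq//; exact: val_inj.
by move=> _ /mapP[i + ->]; rewrite mem_enum => /QB.
Qed.

(** Shearer's inequality for the translates of [E] that meet [F], which cover each point of [F] at
    least |E| times. Those with base point off the boundary lie inside [F], number at most |F| and
    carry at most [M] patterns; the others get the trivial bound. *)
Lemma npat_covering r E F Z (M : nat) : E != fset0 ->
    (forall k, k \in E -> word_ball S r k) -> (0 < M)%N ->
    (forall g, (forall b, word_ball S r b -> (g * b)%g \in F) ->
       (npat (translate g E) Z <= M)%N) ->
  (npat F Z ^ #|` E| <= M ^ #|` F| * #|A| ^ (#|` E| * #|` boundary_fset r F|))%N.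
Proof.
move=> E0 Er M0 ZM; have E1 : (0 < #|` E|)%N by rewrite cardfs_gt0.
have [->|/npat_gt0[x0 _]] := posnP (npat F Z); first by rewrite exp0n.
have A0 : (0 < #|A|)%N by apply/card_gt0P; exists (x0 1%g).
pose P := [fset (h * k^-1)%g | h in F, k in E]%fset.
have PF h (k : E) : h \in F -> (h * (val k)^-1)%g \in P.
  by move=> hF; apply/imfset2P; exists h => //; exists (val k) => //=; exact: valP.
apply: leq_trans (@shearer _ _ P (fun i => translate (val i) E) #|` E| F Z E1 _) _.
  move=> h hF; rewrite cardfE.
  pose f (k : E) : P := [` PF h k hF]%fset.
  have fI : injective f.
    by move=> k k' /(congr1 val)/= /mulgI/invg_inj/val_inj.
  rewrite -(card_imset _ fI); apply: subset_leq_card.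
  apply/fintype.subsetP => _ /imsetP[k _ ->].
  rewrite inE in_translate/= invgM invgK mulgVK; exact: valP.
have good (i : P) : val i \notin boundary_fset r F ->
    forall b, word_ball S r b -> (val i * b)%g \in F.
  move=> iF b rb; apply: contraNT iF => bF.
    apply/in_boundary_fset; split; last by exists b.
  have /imfset2P[h hF [k kE ->]] := valP i.
  by exists k; [exact: Er|rewrite mulgVK].
rewrite (bigID (fun i : P => val i \in boundary_fset r F))/= mulnC leq_mul//.
  apply: leq_trans (_ : \prod_(i : P | val i \notin boundary_fset r F) M <= _)%N.
    by apply: leq_prod => i /good/ZM.
  rewrite prod_nat_const leq_pexp2l//; apply: leq_card_fset => i /good.
  by move=> /(_ _ (word_ball1 r)); rewrite mulg1.
apply: leq_trans
    (_ : \prod_(i : P | val i \in boundary_fset r F) #|A| ^ #|` E| <= _)%N.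
  by apply: leq_prod => i _; rewrite (leq_trans (npat_max _ _))// card_translate.
rewrite prod_nat_const -expnM leq_pexp2l// leq_mul2l; apply/orP; right.
exact: leq_card_fset.
Qed.

End folner.

Section entropy_rate.
Variables (R : realType) (G : groupType) (A : finType) (S : {fset G}).
Hypothesis S_generates : generates S.
Local Notation cfg := (configuration G A).
Implicit Types (K E F : {fset G}) (X Z : set cfg) (x y : cfg) (g h : G).

Lemma folner_le (F : nat -> {fset G}) (u v C : R) r : Folner S R F ->
    (forall n, u * #|` F n|%:R <=
       v * #|` F n|%:R + C * #|` boundary_fset S r (F n)|%:R) ->
  u <= v.
Proof.
move=> [F0 Fr] uv.
have lim : v + C * rho S R r (F n) @[n --> \oo] --> v.
  rewrite -[X in _ --> X]addr0 -[X in _ + X](mulr0 C).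
  by apply: cvgD; [exact: cvg_cst|apply: cvgM; [exact: cvg_cst|exact: Fr]].
rewrite -(cvg_lim _ lim)//; apply: limr_ge; first by apply/cvg_ex; exists v.
apply: nearW => n.
have Fn : 0 < #|` F n|%:R :> R by rewrite ltr0n cardfs_gt0.
by rewrite -(ler_pM2r Fn) mulrDl -mulrA divfK ?gt_eqF.
Qed.

Definition pressure K X : R := ln (npat K X)%:R.

(** The entropy of a nonempty shift, as [entropyE] shows. On the empty set it is 0, because [ln 0]
    is 0, while the entropy is -oo; hence the nonemptiness conditions below. *)
Definition entropy_rate X : R :=
  inf [set pressure K X / #|` K|%:R | K in [set K | K != fset0]].

Definition shift_invariant X := forall g x, X x -> X (shift_act g x).

Lemma pressure_ge0 K X : 0 <= pressure K X.
Proof.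
rewrite /pressure; have [->|n0] := posnP (npat K X); first by rewrite ln0.
by apply: ln_ge0; rewrite ler1n.
Qed.

Lemma entropy_rate_le X K : K != fset0 -> entropy_rate X * #|` K|%:R <= pressure K X.
Proof.
move=> K0; rewrite -ler_pdivlMr ?ltr0n ?cardfs_gt0//.
apply: ge_inf; last by exists K.
by exists 0 => _ [E _ <-]; rewrite divr_ge0 ?pressure_ge0.
Qed.

Lemma entropy_rate_ge X (c : R) :
  (forall K, K != fset0 -> c * #|` K|%:R <= pressure K X) -> c <= entropy_rate X.
Proof.
move=> h; apply: lb_le_inf.
  exists (pressure [fset 1%g]%fset X / #|` [fset 1%g : G]%fset|%:R).
  by exists [fset 1%g]%fset => //=; rewrite -cardfs_gt0 cardfs1.
by move=> _ [K /= K0 <-]; rewrite ler_pdivlMr ?h// ltr0n cardfs_gt0.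
Qed.

Lemma entropy_rate_lt X (e : R) : 0 < e ->
  exists2 K, K != fset0 & pressure K X < (entropy_rate X + e) * #|` K|%:R.
Proof.
move=> e0; apply: contrapT => h.
have : entropy_rate X + e <= entropy_rate X; last by rewrite gerDl leNgt e0.
apply: entropy_rate_ge => K K0; rewrite leNgt; apply/negP => lt; apply: h.
by exists K.
Qed.

Lemma npat_covering_ln r E F Z (M : nat) : E != fset0 ->
    (forall k, k \in E -> word_ball S r k) -> Z !=set0 -> (0 < M)%N ->
    (forall g, (forall b, word_ball S r b -> (g * b)%g \in F) ->
       (npat (translate g E) Z <= M)%N) ->
  #|` E|%:R * pressure F Z <=
    #|` F|%:R * ln M%:R + #|` E|%:R * ln #|A|%:R * #|` boundary_fset S r F|%:R :> R.
Proof.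
move=> E0 Er Z0 M0 ZM; have [x0 _] := Z0.
have A0 : (0 < #|A|)%N by apply/card_gt0P; exists (x0 1%g).
have := npat_covering S_generates E0 Er M0 ZM.
have n0 : (0 < npat F Z)%N by apply/npat_gt0.
rewrite -(ler_nat R) natrM !natrX => le.
rewrite /pressure [leLHS]mulr_natl -lnXn ?ltr0n//.
rewrite [X in _ <= X + _]mulr_natl -mulrA mulrCA -natrM.
rewrite mulr_natr -lnXn ?ltr0n// -lnXn ?ltr0n//.
rewrite -lnM ?posrE ?exprn_gt0 ?ltr0n//.
by rewrite ler_ln ?posrE ?mulr_gt0 ?exprn_gt0 ?ltr0n.
Qed.

(** The quotients are bounded below by their infimum. For the upper bound, a window [E] nearly
    attaining the infimum is translated over [F n], and the boundary term vanishes in the limit. *)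
Lemma pressure_cvg (F : nat -> {fset G}) X : Folner S R F -> X !=set0 ->
    shift_invariant X ->
  pressure (F n) X / #|` F n|%:R @[n --> \oo] --> entropy_rate X.
Proof.
move=> FF X0 Xinv; have [F0 Fr] := FF; have [x0 _] := X0.
apply/cvgrPdist_le => e e0.
have [E E0 lt] := entropy_rate_lt X (divr_gt0 e0 (ltr0Sn R 1)).
have [r Er] := sub_word_ball S E.
have E1 : 0 < #|` E|%:R :> R by rewrite ltr0n cardfs_gt0.
have lim : ln #|A|%:R * rho S R r (F n) @[n --> \oo] --> (0 : R).
  rewrite -(mulr0 (ln #|A|%:R)).
  by apply: cvgM; [exact: cvg_cst|exact: Fr].
move/cvgrPdist_le : lim => /(_ _ (divr_gt0 e0 (ltr0Sn R 1))).
apply: filterS => n; rewrite sub0r normrN => rn.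
have Fn : 0 < #|` F n|%:R :> R by rewrite ltr0n cardfs_gt0.
have le1 : entropy_rate X <= pressure (F n) X / #|` F n|%:R.
  by rewrite ler_pdivlMr// entropy_rate_le.
rewrite ler_norml; apply/andP; split; last first.
  by rewrite lerBlDr (le_trans le1)// lerDr ltW.
rewrite lerBrDr -lerBrDl opprK ler_pdivrMr// -(ler_pM2l E1).
apply: (le_trans (npat_covering_ln (M := npat E X) E0 Er X0 _ _)); last first.
- move: lt; rewrite /pressure => /ltW lt.
  apply: (@le_trans _ _ (#|` F n|%:R * ((entropy_rate X + e / 2) * #|` E|%:R) +
    #|` E|%:R * (e / 2 * #|` F n|%:R))).
    rewrite lerD//; first by rewrite ler_pM2l.
    rewrite -mulrA ler_pM2l// -ler_pdivrMr// -mulrA.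
    by apply: le_trans rn; exact: ler_norm.
  by rewrite [leRHS](_ : _ = #|` F n|%:R * ((entropy_rate X + e / 2) * #|` E|%:R) +
    #|` E|%:R * (e / 2 * #|` F n|%:R))//; field.
- by move=> g _; apply: npat_translate => x; exact: Xinv.
- exact/npat_gt0.
Qed.

Hypothesis G_amenable : amenable S R.

(** Amenability provides a Følner sequence, which pins down the limit that [xget] selects. *)
Lemma entropyE X : X !=set0 -> shift_invariant X ->
  entropy R S X = (entropy_rate X)%:E.
Proof.
move=> X0 Xinv.
have cv (F : nat -> {fset G}) : Folner S R F ->
    entropy_along R F X n @[n --> \oo] --> (entropy_rate X)%:E.
  move=> FF; rewrite (_ : entropy_along R F X =
      fun n => (pressure (F n) X / #|` F n|%:R)%:E).
    by apply: cvg_EFin; [exact: nearW|exact: pressure_cvg].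
  apply/funext => n; rewrite /entropy_along lne_EFin -?EFinM 1?mulrC//.
  by rewrite ltr0n; apply/npat_gt0.
rewrite /entropy; case: xgetP => [h _ hF|/(_ (entropy_rate X)%:E)/(_ cv)//].
have [F FF] := G_amenable.
exact: (cvg_unique _ (hF F FF) (cv F FF)).
Qed.

Lemma entropy_empty : entropy R S (set0 : set cfg) = -oo%E.
Proof.
have cv (F : nat -> {fset G}) : Folner S R F ->
    entropy_along R F (set0 : set cfg) n @[n --> \oo] --> -oo%E.
  move=> [F0 _]; rewrite (_ : entropy_along R F set0 = cst -oo%E).
    exact: cvg_cst.
  apply/funext => n; rewrite /entropy_along.
  have -> : #|patterns (F n) (set0 : set cfg)| = 0%N.
    by apply/eqP; rewrite -leqn0 leqNgt; apply/negP => /npat_gt0[].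
  by rewrite le0_lneNy ?lexx// gt0_muleNy// lte_fin invr_gt0 ltr0n cardfs_gt0.
rewrite /entropy; case: xgetP => [h _ hF|//].
have [F FF] := G_amenable.
exact: (cvg_unique _ (hF F FF) (cv F FF)).
Qed.

End entropy_rate.

(** * The topology of the space of shifts *)

Lemma ultra_finite (T : Type) (B : finType) (U : set_system T) (f : T -> B) :
  UltraFilter U -> exists b, U [set t | f t = b].
Proof.
move=> UU; apply: contrapT => noB.
have : \forall t \near U, forall b, f t <> b.
  apply: filter_forall => b.
  have [Ub|//] := in_ultra_setVsetC [set t | f t = b] UU.
  by exfalso; apply: noB; exists b.
by move=> /filter_ex[t] /(_ (f t)).
Qed.

Section shift_topology.
Variables (G : groupType) (A : finType).
Local Notation cfg := (configuration G A).
Implicit Types (K E F W : {fset G}) (X Z : set cfg) (x y : cfg) (g h : G).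

(** Compactness of A^G: an ultrafilter containing every [P W] selects the symbol of [x] at each
    site. The point [x] is a cluster point and may lie outside [P W]. *)
Lemma cfg_limit (P : {fset G} -> set cfg) :
    (forall W W', (W `<=` W')%fset -> P W' `<=` P W) ->
    (forall W, P W !=set0) ->
  exists x, forall K W, exists2 y, P W y & restrict K y = restrict K x.
Proof.
move=> PS P0.
have FF : ProperFilter (filter_from [set: {fset G}] P).
  apply: filter_from_proper; last by move=> W _; exact: P0.
  apply: filter_from_filter; first by exists fset0.
  move=> W W' _ _; exists (W `|` W')%fset => // x Px.
  by split; apply: PS Px; [exact: fsubsetUl|exact: fsubsetUr].
have [U [UU FU]] := ultraFilterLemma FF.
have Ux g : exists a, U [set y : cfg | y g = a] by exact: ultra_finite.
pose x : cfg := fun g => projT1 (cid (Ux g)).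
exists x => K W.
have UK : U (\bigcap_(k in [set` K]) [set y : cfg | y k = x k]).
  by apply: filter_bigI => k _; exact: (projT2 (cid (Ux k))).
have UW : U (P W) by apply: FU; exists W.
have [y [yK yW]] := filter_ex (filterI UK UW).
by exists y => //; apply/restrictP => k kK; exact: yK.
Qed.

Lemma cfg_closedP X : closed X <-> forall x,
  (forall K, exists2 y, X y & restrict K y = restrict K x) -> X x.
Proof.
split=> [cX x xX|h x xX].
  apply: cX => B; rewrite -nbhs_entourageE => -[E].
  move=> /configuration_entourageP[K KE] EB.
  have [y Xy yx] := xX K; exists y; split => //.
  by apply: EB; apply/mem_set; apply: KE.
apply: h => K.
have [y [Xy xy]] : (X `&` [set y | restrict K x = restrict K y]) !=set0.
  apply: xX; rewrite -nbhs_entourageE.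
  exists [set xy | restrict K xy.1 = restrict K xy.2].
    by apply/configuration_entourageP; exists K.
  by move=> y /xsectionP.
by exists y.
Qed.

Lemma patterns_sub K X Z : X `<=` Z -> patterns K X \subset patterns K Z.
Proof.
move=> XZ; apply/fintype.subsetP => p /patternsP[x Xx <-].
by apply: mem_patterns; exact: XZ.
Qed.

Lemma patterns_eqS K K' X Z : (K `<=` K')%fset ->
  patterns K' X = patterns K' Z -> patterns K X = patterns K Z.
Proof.
move=> /fsubsetP KK'; suff wl X' Z' : patterns K' X' = patterns K' Z' ->
    patterns K X' \subset patterns K Z'.
  by move=> e; apply/eqP; rewrite finset.eqEsubset !wl.
move=> e; apply/fintype.subsetP => _ /patternsP[x Xx <-].
have := mem_patterns K' Xx; rewrite e => /patternsP[z Zz /restrictP zx].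
by apply/patternsP; exists z => //; apply/restrictP => k /KK'/zx.
Qed.

Lemma patterns_hausdorff K X Z : patterns K X = patterns K Z <->
  hausdorff_near [set xy | restrict K xy.1 = restrict K xy.2] (X, Z).
Proof.
split=> [XZ|[/= XZ ZX]].
  split=> /= x /(mem_patterns K).
    by rewrite XZ => /patternsP[z Zz zx]; exists z.
  by rewrite -XZ => /patternsP[z Xz zx]; exists z.
apply/setP => p; apply/patternsP/patternsP => -[x].
  by move=> /XZ[z Zz /= ->]; exists z.
by move=> /ZX[z Xz /= <-]; exists z.
Qed.

Lemma restrict_translate K g x y :
  restrict (translate g^-1 K) x = restrict (translate g^-1 K) y ->
  restrict K (shift_act g x) = restrict K (shift_act g y).
Proof.
move=> /restrictP e; apply/restrictP => k kK.
by rewrite /shift_act e// in_translate mulKg.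
Qed.

Lemma shift_eqP X Z : is_shift X -> is_shift Z ->
  (forall K, patterns K X = patterns K Z) -> X = Z.
Proof.
suff wl X' Z' : is_shift Z' -> (forall K, patterns K X' = patterns K Z') ->
    X' `<=` Z'.
  by move=> sX sZ e; apply/seteqP; split; exact: wl.
move=> [cZ _] e x Xx; move/cfg_closedP: cZ; apply => K.
by have := mem_patterns K Xx; rewrite e => /patternsP.
Qed.

Lemma shift_actE g h x : shift_act g (shift_act h x) = shift_act (g * h)%g x.
Proof. by apply/funext => k; rewrite /shift_act invgM mulgA. Qed.

Lemma shift_act1 x : shift_act 1%g x = x.
Proof. by apply/funext => k; rewrite /shift_act invg1 mul1g. Qed.

(** Shifts given by a local rule: finite type hulls and the avoidance of a pattern are both of this
    form. *)
Lemma local_is_shift K (P : set {ffun K -> A}) :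
  is_shift [set x | forall g, P (restrict K (shift_act g x))].
Proof.
split=> [|g x /= h k]; last by rewrite shift_actE.
apply/cfg_closedP => x xX g /=.
have [y Xy] := xX (translate g^-1 K).
by move=> /restrict_translate <-; exact: Xy.
Qed.

Lemma is_shiftI X Z : is_shift X -> is_shift Z -> is_shift (X `&` Z).
Proof.
move=> [cX iX] [cZ iZ]; split; first exact: closedI.
by move=> g x [/iX Xx /iZ Zx]; split; [exact: Xx|exact: Zx].
Qed.

(** The finite type approximation of [X] with window [K]. Inclusion of the hull in [X] is how finite
    type is expressed below. *)
Definition sft_hull K X : set cfg :=
  [set x | forall g, restrict K (shift_act g x) \in patterns K X].

Lemma sft_hull_shift K X : is_shift (sft_hull K X).
Proof. exact: (local_is_shift [set p | p \in patterns K X]). Qed.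

Lemma sub_sft_hull K X : shift_invariant X -> X `<=` sft_hull K X.
Proof. by move=> iX x Xx g; apply: mem_patterns; exact: iX. Qed.

Lemma patterns_sft_hull K X : shift_invariant X ->
  patterns K (sft_hull K X) = patterns K X.
Proof.
move=> iX; apply/eqP; rewrite finset.eqEsubset andbC patterns_sub/=; last first.
  exact: sub_sft_hull.
apply/fintype.subsetP => _ /patternsP[x xX <-].
by have := xX 1%g; rewrite shift_act1.
Qed.

End shift_topology.

(** * The space of shifts of entropy at least [c] *)

Section cantor.
Variables (R : realType) (G : groupType) (A : finType) (S : {fset G}).
Hypothesis S_generates : generates S.
Hypothesis G_amenable : amenable S R.
Local Notation cfg := (configuration G A).
Implicit Types (K E F W : {fset G}) (X Z : set cfg) (x y : cfg) (g h : G).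

(** One condition for each finite window: in this form the bound passes to limits of shifts and to
    larger shifts. *)
Lemma entropy_geP (c : R) X : shift_invariant X -> (c%:E <= entropy R S X)%E <->
  X !=set0 /\ forall K, K != fset0 -> c * #|` K|%:R <= pressure R K X.
Proof.
move=> iX; have [->|X0] := eqVneq X set0.
  by rewrite entropy_empty// leNgt ltNyr; split => // -[[]].
move/set0P : X0 => X0; rewrite entropyE// lee_fin.
split=> [ch|[_ ch]]; last exact: entropy_rate_ge.
split => //.
by move=> K K0; apply: le_trans (entropy_rate_le R X K0); rewrite ler_wpM2r.
Qed.

Variable c : R.
Local Notation T := (set_type (entropy_ge A S c)).
Local Notation pat K Y := (patterns K (set_val (set_val Y))).
Local Notation cyl K X := [set Y : T | pat K Y = pat K X].

Lemma nbhs_entropy_geP (X : T) (P : set T) :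
  nbhs X P <-> exists K, cyl K X `<=` P.
Proof.
split.
  move=> [_ [[V oV <-] VX VP]].
  have /nbhs_shiftP[K KV] : nbhs (set_val X) V by exact: open_nbhs_nbhs.
  by exists K => Y /= YX; apply: VP; exact: KV.
move=> [K KP].
apply: (@filterS _ _ _ (set_val @^-1`
    [set Z : shift_space G A | patterns K (set_val Z) = pat K X])).
  by move=> Y /KP.
apply: (@initial_continuous T _ set_val).
by apply/nbhs_shiftP; exists K.
Qed.

Lemma shift_inj (X Y : T) : (forall K, pat K X = pat K Y) -> X = Y.
Proof.
move=> XY; apply: val_inj; apply: val_inj.
by apply: shift_eqP => //; exact: set_valP.
Qed.

Lemma entropy_ge_zero_dimensional : zero_dimensional T.
Proof.
move=> X Y XY; have [K XYK] : exists K, pat K X != pat K Y.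
  apply: contrapT => h; move/eqP : XY; apply; apply: shift_inj => K.
  by apply/eqP; apply: contrapT => /negP; apply: contra_not h => ?; exists K.
exists (cyl K X); split => //=; last by apply/eqP; rewrite eq_sym.
split.
  rewrite openE => Z /= ZX; apply/nbhs_entropy_geP.
  by exists K => Z' /= ->.
move=> Z ZX.
have [Z' [/= <- ->//]] : (cyl K X `&` cyl K Z) !=set0.
by apply: ZX; apply/nbhs_entropy_geP; exists K.
Qed.

Lemma entropy_ge_hausdorff : hausdorff_space T.
Proof.
move=> X Y XY; apply: shift_inj => K.
have [||Z [/= <- <-]//] := XY (cyl K X) (cyl K Y).
- by apply/nbhs_entropy_geP; exists K.
- by apply/nbhs_entropy_geP; exists K.
Qed.

Lemma entropy_ge_entourageP (W : set (T * T)) : entourage W <->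
  exists K, [set XY : T * T | pat K XY.1 = pat K XY.2] `<=` W.
Proof.
split=> [[V1 [V2 [E /configuration_entourageP[K KE] EV2] V21] V1W]|[K KW]].
  exists K => -[X Y] /= XY; apply: V1W; apply: V21; apply: EV2.
  exact/(hausdorff_nearS KE)/patterns_hausdorff.
exists [set XY : shift_space G A * shift_space G A |
    patterns K (set_val XY.1) = patterns K (set_val XY.2)]; last first.
  by move=> [X Y] /= XY; apply: KW.
exists (hausdorff_near [set xy : cfg * cfg | restrict K xy.1 = restrict K xy.2]).
  exists [set xy | restrict K xy.1 = restrict K xy.2] => //.
  by apply/configuration_entourageP; exists K.
by move=> [X Y] /= /patterns_hausdorff.
Qed.

(** Word balls are cofinal among the finite subsets of [G]. *)
Lemma entropy_ge_countable_uniformity : countable_uniformity T.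
Proof.
apply/countable_uniformityP.
exists (fun n => [set XY : T * T |
    pat (fset_set (word_ball S n)) XY.1 = pat (fset_set (word_ball S n)) XY.2]).
  move=> W /entropy_ge_entourageP[K KW]; have [n Kn] := sub_word_ball S K.
  exists n => XY /= e; apply: KW; apply: patterns_eqS e.
  apply/fsubsetP => k /Kn kn; rewrite in_fset_set ?inE//.
  exact: finite_word_ball.
by move=> n; apply/entropy_ge_entourageP; exists (fset_set (word_ball S n)).
Qed.

(** An ultrafilter fixes a set of patterns [p K] for each window, and [p2] realises any two of these
    in one shift. The limit [X] consists of the configurations with all patterns in these sets; it
    inherits the entropy bound window by window. *)
Lemma entropy_ge_compact : compact [set: T].
Proof.
rewrite compact_ultra => U UU _.
have UP K : exists p, U [set Y : T | pat K Y = p].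
  exact: (ultra_finite (fun Y : T => pat K Y)).
pose p K := projT1 (cid (UP K)).
have pU K : U [set Y : T | pat K Y = p K] := projT2 (cid (UP K)).
have p2 K K' : exists Y : T, pat K Y = p K /\ pat K' Y = p K'.
  exact: filter_ex (filterI (pU K) (pU K')).
pose X : set cfg := [set x | forall K, restrict K x \in p K].
have pX K : patterns K X = p K.
  apply/eqP; rewrite finset.eqEsubset; apply/andP; split.
    by apply/fintype.subsetP => _ /patternsP[x Xx <-]; exact: Xx.
  apply/fintype.subsetP => q qK.
  (* Extending a pattern in [p K] to a whole point of [X] takes compactness of A^G. *)
  pose P W := [set x : cfg | restrict K x = q /\ restrict W x \in p W].
  have [||x xP] := @cfg_limit _ _ P.
  - move=> W W' /fsubsetP WW' x [xq xW']; split => //.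
    have [Y [YW YW']] := p2 W W'; move: xW'.
    rewrite -YW' -YW => /patternsP[y Yy /restrictP yx].
    by apply/patternsP; exists y => //; apply/restrictP => k /WW'/yx.
  - move=> W; have [Y [YK YW]] := p2 K W; move: qK.
    rewrite -YK => /patternsP[y Yy yq]; exists y; split => //.
    by rewrite -YW; exact: mem_patterns.
  apply/patternsP; exists x.
    by move=> W; have [y [_ yW] <-] := xP W W.
  by have [y [yq _] <-] := xP K K.
have sX : is_shift X.
  split; first by apply/cfg_closedP => x xX K; have [y Xy <-] := xX K.
  move=> g x Xx K; have [Y [YK YgK]] := p2 K (translate g^-1 K).
  have := Xx (translate g^-1 K); rewrite -YgK -YK.
  move=> /patternsP[y Yy /restrict_translate <-].
  by apply: mem_patterns; apply: (set_valP (set_val Y)).2.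
have eX : (c%:E <= entropy R S X)%E.
  apply/entropy_geP; first exact: sX.2.
  have key K : exists Y : T, pat K Y = patterns K X.
    by have [Y [YK _]] := p2 K K; exists Y; rewrite YK pX.
  split.
    have [Y YX] := key fset0; apply/(npat_gt0 fset0); rewrite /npat -YX.
    apply/npat_gt0.
    by have /entropy_geP[] := set_valP Y; first exact: (set_valP (set_val Y)).2.
  move=> K K0; have [Y YX] := key K; rewrite /pressure /npat -YX.
  have /entropy_geP[] := set_valP Y; first exact: (set_valP (set_val Y)).2.
  by move=> _; exact.
pose X1 : shift_space G A := SigSub (mem_set sX).
have X1c : entropy_ge A S c X1 by [].
exists (SigSub (mem_set X1c)); split => // V /nbhs_entropy_geP[K KV].
by apply: filterS (pU K) => Y /= YK; apply: KV; rewrite /= YK pX.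
Qed.

(** Brouwer's characterisation of the Cantor space as the nonempty, perfect, compact, metrizable,
    zero-dimensional space. *)
Lemma entropy_ge_homeomorphic : isolated (entropy_ge A S c) = set0 ->
  entropy_ge A S c !=set0 -> homeomorphic T cantor_space.
Proof.
move=> iso0 [X0 X0c]; pose P0 : T := SigSub (mem_set X0c).
have perf : perfect_set [set: T].
  apply/perfectTP => X oX; have : isolated (entropy_ge A S c) (set_val X).
    split; first exact/mem_set/set_valP.
    have /nbhs_entropy_geP[K KX] : nbhs X [set X] by exact: open_nbhs_nbhs.
    exists [set Z : shift_space G A | patterns K (set_val Z) = pat K X].
      by apply/nbhs_shiftP; exists K.
    apply/seteqP; split=> [Z [/= ZX Zc]|_ -> //]; last first.
      by split => //; exact: set_valP.
    by rewrite -(KX (SigSub (mem_set Zc)) ZX).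
  by rewrite iso0.
(* The characterisation concerns pointed pseudometric spaces: the countable uniformity gives the
   pseudometric, [P0] the base point. *)
unshelve epose (PM := countable_uniform entropy_ge_countable_uniformity
    : pseudoPMetricType R).
  exact: Pointed.class (HB.pack_for pointedType T (isPointed.Build T P0)).
have cl : cantor_like PM.
  split; [exact: perf|exact: entropy_ge_compact|exact: entropy_ge_hausdorff|].
  exact: entropy_ge_zero_dimensional.
have [f [fc fcl]] := homeomorphism_cantor_like cl.
pose g : T -> cantor_space := f^-1%FUN.
have gK : cancel g f by move=> x; apply: invK; rewrite inE.
have fK : cancel f g by move=> x; apply: funK; rewrite inE.
exists g, f; split => //.
(* The inverse [g] is continuous because [f] is a closed map. *)
apply/continuous_closedP => B /fcl.
congr (closed _); apply/seteqP; split=> [_ [b Bb <-]|x Bx].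
  by rewrite /= fK.
by exists (g x).
Qed.

End cantor.

(** * Forbidding a pattern *)

Lemma bernoulli_le (R : realDomainType) (t : R) d : 0 <= t <= 1 ->
  1 - d%:R * t <= (1 - t) ^+ d.
Proof.
move=> /andP[t0 t1]; elim: d => [|d IH]; first by rewrite mul0r subr0 expr0.
have t1' : 0 <= 1 - t by rewrite subr_ge0.
rewrite exprS; apply: le_trans (ler_wpM2l t1' IH).
rewrite -subr_ge0 (_ : _ - _ = d%:R * t ^+ 2) ?mulr_ge0 ?sqr_ge0//.
by rewrite -natr1; ring.
Qed.

(* A counting substitute for the Lovasz local lemma: by induction, every
   further forbidden site costs a factor at least [1 - 2 p], because undoing
   the at most [d] nearby constraints costs at most a factor 2. *)
Lemma forbidden_sites (R : realFieldType) (T : choiceType) (D : {fset T})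
    (n : {fset T} -> R) (p : R) (d : nat) :
    0 <= p -> (0 < d)%N -> 4 * d%:R * p <= 1 -> (forall W, 0 <= n W) ->
    (forall W g, (W `<=` D)%fset -> g \in D -> g \notin W ->
      exists W', [/\ (W' `<=` W)%fset, (#|` W `\` W'|%fset <= d)%N &
        n W <= n (g |` W)%fset + p * n W']) ->
  forall W, (W `<=` D)%fset -> (1 - 2 * p) ^+ #|` W| * n fset0 <= n W.
Proof.
move=> p0 d0 dp n0 step; set a := 1 - 2 * p.
have p4 : 4 * p <= 1.
  apply: le_trans dp; rewrite -mulrA ler_pM2l// ler_peMl//.
  by rewrite ler1n.
have a0 : 0 <= a by rewrite /a; lra.
have a1 : a <= 1 by rewrite /a; lra.
(* Bernoulli's inequality, as 1 - 2 d p is at least 1/2. *)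
have ad : 1 / 2 <= a ^+ d.
  have tb : 0 <= 2 * p <= 1 by apply/andP; split; lra.
  apply: le_trans (bernoulli_le d tb); lra.
(* The sites of [W] outside [W'] are removed one at a time, each at the cost of a factor [a]. *)
have chain m : (forall W g, (#|` W| < m)%N -> (W `<=` D)%fset -> g \in D ->
      g \notin W -> a * n W <= n (g |` W)%fset) ->
    forall W W', (W' `<=` W)%fset -> (#|` W| <= m)%N -> (W `<=` D)%fset ->
    a ^+ #|` (W `\` W')%fset| * n W' <= n W.
  move=> st W W'; move e : #|` (W `\` W')%fset| => k.
  elim: k W e => [|k IH] W e W'W Wm WD.
    have /eqP := e; rewrite cardfs_eq0 fsetD_eq0 => WW'.
    have -> : W = W' by apply/eqP; rewrite eqEfsubset WW'.
    by rewrite expr0 mul1r.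
  have [w wW] : exists w, w \in (W `\` W')%fset.
    by apply/fset0Pn; rewrite -cardfs_gt0 e.
  have /andP[wW' wW1] : (w \notin W') && (w \in W) by move: wW; rewrite inE.
  have eW : (w |` (W `\ w) = W)%fset by rewrite fsetD1K.
  have cW := cardfsD1 w W; rewrite wW1 in cW.
  rewrite exprS -mulrA; apply: (@le_trans _ _ (a * n (W `\ w)%fset)).
    rewrite ler_wpM2l//; apply: IH.
    - have := cardfsD1 w (W `\` W')%fset; rewrite wW e => -[->].
      by rewrite fsetDDl fsetUC -fsetDDl.
    - by rewrite fsubsetD1 W'W.
    - by apply: leq_trans Wm; rewrite cW leqnSn.
    - exact: fsubset_trans (fsubD1set _ _) WD.
  rewrite -[in leRHS]eW; apply: st.
  - by apply: leq_trans Wm; rewrite cW.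
  - exact: fsubset_trans (fsubD1set _ _) WD.
  - by move/fsubsetP : WD; apply.
  - by rewrite !inE eqxx.
have main m W g : (#|` W| < m)%N -> (W `<=` D)%fset -> g \in D ->
    g \notin W -> a * n W <= n (g |` W)%fset.
  elim: m W g => [//|m IH] W g; rewrite ltnS => Wm WD gD gW.
  have [W' [W'W dW le]] := step W g WD gD gW.
  (* At most [d] sites separate [W'] from [W], so [n W'] is at most twice [n W]. *)
  have := chain m IH W W' W'W Wm WD.
  move=> /(le_trans _) => /(_ (1 / 2 * n W')) h.
  have {}h : 1 / 2 * n W' <= n W.
    apply: h; rewrite ler_wpM2r//; apply: (le_trans ad).
    exact: ler_wiXn2l.
  have : p * n W' <= p * (2 * n W) by rewrite ler_wpM2l//; lra.
  rewrite /a; lra.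
move=> W WD.
have := chain #|` W| (fun V g _ => main #|` V|.+1 V g (ltnSn _)) W fset0.
by rewrite fsetD0 fsub0set; apply.
Qed.

Lemma leq_card_imfset2 (T1 T2 T : choiceType) (f : T1 -> T2 -> T)
    (P : {fset T1}) (Q : {fset T2}) :
  (#|` [fset f a b | a in P, b in Q]%fset| <= #|` P| * #|` Q|)%N.
Proof.
rewrite -(size_allpairs f); apply: uniq_leq_size; first exact: fset_uniq.
move=> _ /imfset2P[a aP [b bQ ->]].
by apply/allpairsP; exists (a, b).
Qed.

Section avoid.
Variables (G : groupType) (A : finType) (S : {fset G}).
Hypothesis S_generates : generates S.
Local Notation cfg := (configuration G A).
Implicit Types (K E F W : {fset G}) (X Z : set cfg) (x y q : cfg) (g h : G).

Lemma npatU F X Z : (npat F (X `|` Z) <= npat F X + npat F Z)%N.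
Proof.
apply: leq_trans (leq_card_setU _ _); apply: subset_leq_card.
apply/fintype.subsetP => _ /patternsP[x [Xx|Zx] <-]; rewrite finset.in_setU.
  by rewrite mem_patterns.
by rewrite orbC mem_patterns.
Qed.

Lemma npat_bigcup F (I : finType) (Z : I -> set cfg) X :
  X `<=` \bigcup_i Z i -> (npat F X <= \sum_i npat F (Z i))%N.
Proof.
move=> XZ.
pose U : {set {ffun F -> A}} :=
  \big[@finset.setU _/@finset.set0 _]_i patterns F (Z i).
apply: (@leq_trans #|U|).
  apply: subset_leq_card; apply/fintype.subsetP => _ /patternsP[x /XZ[i _ Zx] <-].
  by apply/finset.bigcupP; exists i => //; exact: mem_patterns.
rewrite /U; elim/big_ind2 : _ => [|a b c d ba dc|i _]; first by rewrite cards0.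
  by apply: leq_trans (leq_card_setU _ _) _; exact: leq_add.
by [].
Qed.

Definition patch F x y : cfg := fun h => if h \in F then y h else x h.

Definition shell r F : {fset G} :=
  [fset (g * b)%g | g in boundary_fset S r F, b in fset_set (word_ball S r)]%fset.

(** Each translate of the window [K] sees only [x] or only [y]: if its base point is on the boundary
    it lies in the shell, where [x] and [y] agree on [F]; otherwise it lies inside [F] or misses
    it. *)
Lemma patch_mem r K F X x y : (forall k, k \in K -> word_ball S r k) ->
    shift_invariant X -> sft_hull K X `<=` X -> X x -> X y ->
    (forall h, h \in F -> h \in shell r F -> x h = y h) -> X (patch F x y).
Proof.
move=> Kr iX hX Xx Xy xy; apply: hX => g.
have [gb|gb] := boolP (g^-1%g \in boundary_fset S r F).
  rewrite (_ : restrict K _ = restrict K (shift_act g x)).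
    by apply: mem_patterns; exact: iX.
  apply/restrictP => k kK; rewrite /shift_act /patch.
  case: ifPn => // kF; rewrite xy//; apply/imfset2P; exists g^-1%g => //.
  exists k => //=; rewrite in_fset_set ?inE; first exact: Kr.
  exact: finite_word_ball.
have [[k kK kF]|nF] := pselect (exists2 k, k \in K & (g^-1 * k)%g \in F).
  rewrite (_ : restrict K _ = restrict K (shift_act g y)).
    by apply: mem_patterns; exact: iX.
  apply/restrictP => k' k'K; rewrite /shift_act /patch.
  case: ifPn => // k'F; exfalso; move/negP : gb; apply; apply/in_boundary_fset => //.
  by split; [exists k => //; exact: Kr|exists k' => //; exact: Kr].
rewrite (_ : restrict K _ = restrict K (shift_act g x)).
  by apply: mem_patterns; exact: iX.
apply/restrictP => k kK; rewrite /shift_act /patch.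
by case: ifPn => // kF; exfalso; apply: nF; exists k.
Qed.

Definition occurs F q x g := restrict F (shift_act g^-1 x) = restrict F q.

Lemma occursP F q x g :
  occurs F q x g <-> forall f, f \in F -> x (g * f)%g = q f.
Proof.
rewrite /occurs restrictP; split=> h f /h; rewrite /shift_act ?invgK //.
Qed.

Definition avoid X F q W := [set x | X x /\ forall g, g \in W -> ~ occurs F q x g].

Definition avoid_all X F q := [set x | X x /\ forall g, ~ occurs F q x g].

Lemma avoidS X F q W W' : (W `<=` W')%fset -> avoid X F q W' `<=` avoid X F q W.
Proof. by move=> /fsubsetP WW' x [Xx xW]; split => // g /WW'/xW. Qed.

Lemma avoid_all_shift X F q : is_shift X -> is_shift (avoid_all X F q).
Proof.
move=> sX; pose P := [set p : {ffun F -> A} | p <> restrict F q].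
rewrite (_ : avoid_all X F q =
    X `&` [set x | forall g, P (restrict F (shift_act g x))]).
  exact: is_shiftI sX (local_is_shift _).
apply/seteqP; split=> x [Xx xP]; split => // g.
  by have := xP g^-1%g; rewrite /occurs invgK.
exact: xP.
Qed.

(** Compactness passes from finite sets of sites to all sites; [C] survives in the limit because it
    depends only on the window [E]. *)
Lemma avoid_limit X F q (C : set cfg) E : is_shift X ->
    (forall x y, restrict E x = restrict E y -> C x -> C y) ->
    (forall W, avoid X F q W `&` C !=set0) ->
  avoid_all X F q `&` C !=set0.
Proof.
move=> [cX iX] EC avC.
have [||x xP] := @cfg_limit _ _ (fun W => avoid X F q W `&` C).
- by move=> W W' WW' x [/(avoidS WW') ? ?].
- exact: avC.
exists x; split; last by have [y [_ Cy] yx] := xP E fset0; exact: EC yx Cy.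
split=> [|g].
  move/cfg_closedP : cX; apply => K; have [y [[Xy _] _] yx] := xP K fset0.
  by exists y.
have [y [[_ yg] _] /restrictP yx] := xP (translate g F) [fset g]%fset.
move=> /occursP xg; apply: (yg g); first by rewrite inE.
by apply/occursP => f fF; rewrite yx ?xg// in_translate mulKg.
Qed.

(* Preserving the content of [shell r F] makes an exchange inside [F] legal in
   a shift of finite type; preserving that of [g^-1 K] leaves the content of
   [K] unchanged when the exchange takes place at [g]. *)
Definition frozen r F K g : {fset G} :=
  (shell r F `|` (translate g^-1 K `&` F))%fset.

Definition exchanges X r F K q g : set cfg :=
  [set y | X y /\ restrict (frozen r F K g) y = restrict (frozen r F K g) q].

Section count.
Variables (R : realFieldType) (r : nat) (K0 K F : {fset G}) (X : set cfg).
Variables (q : cfg) (N : nat).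
Hypothesis K0r : forall k, k \in K0 -> word_ball S r k.
Hypothesis iX : shift_invariant X.
Hypothesis hX : sft_hull K0 X `<=` X.
Hypothesis N_exchanges : forall g, (N <= npat F (exchanges X r F K q g))%N.

(** Fixing the content of [K] allows every pattern of [X] on [K] to be kept; the empty [K] gives all
    of [X]. *)
Let Om p0 := [set x | X x /\ restrict K x = restrict K p0].

(** Resampling: an occurrence of [q] at [g] is overwritten by any of at least [N] exchanges. The
    result stays in [Om p0] and still avoids [q] at those sites of [W] whose translate of [F] is
    disjoint from gF. *)
Lemma exchange_occurrence p0 F' W g :
    (forall f, f \in F -> (g * f)%g \in F') ->
  (npat F' [set x | avoid (Om p0) F q W x /\ occurs F q x g] * N <=
   npat F' (avoid (Om p0) F q
     [fset j in W | [forall f : F, forall f' : F,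
        (j * val f)%g != (g * val f')%g]]%fset))%N.
Proof.
move=> gF; apply: leq_trans
    (_ : npat F' [set x | avoid (Om p0) F q W x /\ occurs F q x g] *
         npat F (exchanges X r F K q g) <= _)%N.
  by rewrite leq_mul2l N_exchanges orbT.
apply: (npat_mul (f := fun x y => shift_act g (patch F (shift_act g^-1 x) y))).
  move=> x y [[[Xx xK] xW] /occursP xg] [Xy /restrictP yq].
  split; first split.
  - apply: iX; apply: (patch_mem K0r) => //; first exact: iX.
    move=> h hF hs; rewrite /shift_act invgK xg// yq//.
    by rewrite /frozen in_fsetU hs.
  - rewrite -xK; apply/restrictP => k kK; rewrite /shift_act /patch.
    case: ifPn => kF; last by rewrite invgK mulVKg.
    rewrite yq; first by rewrite -xg// mulVKg.
    rewrite /frozen in_fsetU in_fsetI kF andbT in_translate invgK mulVKg.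
    by rewrite kK orbT.
  - move=> j; rewrite !inE => /andP[jW /forallP jF] /occursP jq.
    apply: (xW j jW); apply/occursP => f fF; rewrite -jq// /shift_act /patch.
    case: ifPn => jf; last by rewrite invgK mulVKg.
    have /forallP/(_ (FSetSub jf)) := jF (FSetSub fF).
    by rewrite /= mulVKg eqxx.
(* Injectivity: the result shows [x] outside gF and [y] inside, where [x] is known to be [q]. *)
move=> x y x' y' [_ /occursP xg] _ [_ /occursP x'g] _ /restrictP e; split.
  apply/restrictP => h hF; have := e h hF; rewrite /shift_act /patch.
  case: ifPn => hg; last by rewrite invgK mulVKg.
  by move=> _; rewrite -[h](mulVKg g) xg// x'g.
apply/restrictP => f fF; have := e _ (gF f fF).
by rewrite /shift_act /patch mulKg fF.
Qed.

Hypothesis F0 : F != fset0.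
Hypothesis N_large : (4 * #|` F| ^ 2 <= N)%N.

(** [forbidden_sites] applies with p = 1/N and d = |F|^2: if jF meets gF, then [j] lies in g F F^-1,
    which has at most |F|^2 elements. *)
Lemma npat_avoid p0 F' W : (forall g f, g \in W -> f \in F -> (g * f)%g \in F') ->
  (1 - 2 / N%:R) ^+ #|` W| * (npat F' (Om p0))%:R <=
    (npat F' (avoid (Om p0) F q W))%:R :> R.
Proof.
move=> WF; have F1 : (0 < #|` F|)%N by rewrite cardfs_gt0.
have N0 : (0 < N)%N by apply: leq_trans N_large; rewrite muln_gt0 expn_gt0 F1.
have NR : 0 < N%:R :> R by rewrite ltr0n.
rewrite (_ : npat F' (Om p0) = npat F' (avoid (Om p0) F q fset0)); last first.
  by congr npat; apply/seteqP; split=> [x Ox|x []].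
apply: (@forbidden_sites _ _ W (fun W => (npat F' (avoid (Om p0) F q W))%:R)
  N%:R^-1 (#|` F| ^ 2)%N) => //.
- by rewrite expn_gt0 F1.
- by rewrite ler_pdivrMr// mul1r -natrM ler_nat.
move=> W1 g W1W gW _; set near := [fset j in W1 | [forall f : F, forall f' : F,
  (j * val f)%g != (g * val f')%g]]%fset.
exists near; split.
- by apply/fsubsetP => j; rewrite !inE => /andP[].
- apply: leq_trans (_ : #|` [fset (g * f)%g |
      f in [fset (f * f'^-1)%g | f in F, f' in F]]%fset| <= _)%N.
    apply: fsubset_leq_card; apply/fsubsetP => j; rewrite !inE.
    move=> /andP[+ jW1]; rewrite jW1/= => /forallPn[f /forallPn[f' /negPn/eqP jf]].
    apply/imfsetP; exists (val f' * (val f)^-1)%g => /=.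
      apply/imfset2P; exists (val f'); first exact: valP.
      by exists (val f) => //; exact: valP.
    by rewrite mulgA -jf mulgK.
  apply: leq_trans (leq_card_imfset2 (fun f f' => f * f'^-1)%g F F).
  exact: leq_imfset_card.
rewrite -[leRHS]/(_ + _ * _).
apply: (@le_trans _ _ ((npat F' (avoid (Om p0) F q (g |` W1)%fset))%:R +
  (npat F' [set x | avoid (Om p0) F q W1 x /\ occurs F q x g])%:R)).
  rewrite -natrD ler_nat; apply: leq_trans (npatU _ _ _).
  apply: npatS => // x [Ox xW1].
  have [xg|xg] := pselect (occurs F q x g); first by right.
  by left; split => // j; rewrite !inE => /orP[/eqP ->|/xW1].
rewrite lerD2l mulrC ler_pdivlMr// -natrM ler_nat.
by apply: exchange_occurrence => f; exact: WF.
Qed.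

End count.

End avoid.

(** * Patterns with many exchanges *)

Section many_exchanges.
Variables (R : realType) (G : groupType) (A : finType) (S : {fset G}).
Hypothesis S_generates : generates S.
Local Notation cfg := (configuration G A).
Implicit Types (K E F W : {fset G}) (X Z : set cfg) (x y q : cfg) (g h : G).

Lemma folner_bnd (F : nat -> {fset G}) r (e : R) : Folner S R F -> 0 < e ->
  \forall n \near \oo, #|` boundary_fset S r (F n)|%:R <= e * #|` F n|%:R.
Proof.
move=> [F0 Fr] e0; have /cvgrPdist_le/(_ e e0) := Fr r.
apply: filterS => n; rewrite sub0r normrN => /(le_trans (ler_norm _)).
by rewrite ler_pdivrMr ?ltr0n ?cardfs_gt0.
Qed.

(** If |F n| < |B|, no translate of [B] fits into [F n], so every point of [F n] is a boundary
    point; this fails for large [n]. *)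
Lemma folner_card (F : nat -> {fset G}) (m : nat) : infinite_set [set: G] ->
  Folner S R F -> \forall n \near \oo, (m <= #|` F n|)%N.
Proof.
move=> Ginf FF; have [F0 _] := FF.
have [B _ mB] := infinite_set_fset m Ginf.
have [r Br] := sub_word_ball S B.
have half : 0 < 1 / 2 :> R by lra.
apply: filterS (folner_bnd r FF half) => n bn.
rewrite leqNgt; apply/negP => Fm.
have : (#|` F n| <= #|` boundary_fset S r (F n)|)%N.
  apply: fsubset_leq_card; apply/fsubsetP => f fF.
  apply/in_boundary_fset => //; split.
    by exists 1%g; [exact: word_ball1|rewrite mulg1].
  apply: contrapT => h; have : (#|` translate f B| <= #|` F n|)%N.
    apply: fsubset_leq_card; apply/fsubsetP => _ /imfsetP[b bB ->].
    by apply: contrapT => /negP fb; apply: h; exists b => //; exact: Br.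
  by rewrite card_translate leqNgt (leq_trans Fm mB).
rewrite -(ler_nat R) => /le_trans/(_ bn).
have : 0 < #|` F n|%:R :> R by rewrite ltr0n cardfs_gt0.
lra.
Qed.

(* If no pattern had many exchanges, then the patterns of [X] on [F] would be
   determined up to polynomially many choices by their frozen part. *)
Lemma npat_few_exchanges r K F X N : K != fset0 -> F != fset0 ->
    (forall q, X q -> exists g, (npat F (exchanges S X r F K q g) < N)%N) ->
  (npat F X <= #|` K| * #|` F| * (#|A| ^ (#|` shell S r F| + #|` K|) * N))%N.
Proof.
move=> K0 F0 few.
have [->//|/npat_gt0[x0 _]] := posnP (npat F X).
have A0 : (0 < #|A|)%N by apply/card_gt0P; exists (x0 1%g).
(* The translate g^-1 K meets [F] only for [g] in [P]. For other [g] nothing is frozen but the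
   shell, so a lack of exchanges at [g] implies one at the element given by [P0]. *)
pose P := [fset (k * f^-1)%g | k in K, f in F]%fset.
have [k0 k0K] : exists k, k \in K by apply/fset0Pn.
have [f0 f0F] : exists f, f \in F by apply/fset0Pn.
have P0 : (k0 * f0^-1)%g \in P.
  by apply/imfset2P; exists k0 => //; exists f0.
pose Z g := [set q | X q /\ (npat F (exchanges S X r F K q g) < N)%N].
have XZ : X `<=` \bigcup_(i : P) Z (val i).
  move=> q Xq; have [g gq] := few q Xq.
  have [gP|gP] := boolP (g \in P); first by exists (FSetSub gP).
  exists (FSetSub P0) => //; split => //; apply: leq_ltn_trans gq.
  apply: npatS => // y [Xy /restrictP yq]; split => //.
  apply/restrictP => h; rewrite /frozen inE => hfr.
  apply: yq; rewrite /frozen inE; apply/orP; left.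
  move: hfr => /orP[//|]; rewrite inE in_translate invgK => /andP[ghK hF].
  exfalso; move/negP : gP; apply; apply/imfset2P; exists (g * h)%g => //.
  by exists h => //; rewrite mulgK.
apply: leq_trans (npat_bigcup F XZ) _.
apply: leq_trans (_ : \sum_(i : P) #|A| ^ (#|` shell S r F| + #|` K|) * N <= _)%N.
  apply: leq_sum => i _.
  apply: leq_trans (npat_classes (K := frozen S r F K (val i)) (M := N) _) _.
    move=> q [Xq /ltnW/(leq_trans _)]; apply.
    by apply: npatS => // y [[Xy _] yq].
  rewrite leq_mul2r; apply/orP; right; apply: leq_trans (npat_max _ _) _.
  rewrite leq_pexp2l// /frozen; apply: leq_trans (leq_card_fsetU _ _) _.
  rewrite leq_add2l; apply: leq_trans (fsubset_leq_card (fsubsetIl _ _)) _.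
  by rewrite card_translate.
rewrite sum_nat_const leq_mul2r; apply/orP; right.
rewrite -cardfE; apply: leq_trans (leq_card_imfset2 (fun k f => k * f^-1)%g K F) _.
by [].
Qed.

(** Makes a logarithm negligible against a linear term of arbitrarily small slope. *)
Lemma ln_le_scale (x d : R) : 0 < x -> 0 < d -> ln x <= d * x - ln d.
Proof.
move=> x0 d0; have /ltW := @ln_sublinear R (d * x) (mulr_gt0 d0 x0).
rewrite lnM ?posrE//; lra.
Qed.

(** Otherwise the logarithm of the number of patterns on [F n] is at most a constant plus 3 ln |F n|
    plus a boundary term, while positive entropy makes it grow linearly. Of the three factors |F n|,
    one locates [g] and two come from the bound on exchanges. *)
Lemma exists_exchanges r K X (N0 : nat) : infinite_set [set: G] ->
    amenable S R -> K != fset0 -> (0 < N0)%N -> 0 < entropy_rate R X ->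
  exists F q, [/\ F != fset0, X q & forall g,
    (N0 * #|` F| ^ 2 <= npat F (exchanges S X r F K q g))%N].
Proof.
move=> Ginf [F FF] K0 N00 h0; have [F0 _] := FF.
apply: contrapT => none.
have A0 : (0 < #|A|)%N.
  rewrite lt0n; apply/eqP => A0; suff : entropy_rate R X <= 0 by rewrite leNgt h0.
  have := entropy_rate_le R X K0; rewrite /pressure.
  have -> : npat K X = 0%N.
    apply/eqP; rewrite -leqn0 leqNgt; apply/negP => /npat_gt0[x _].
    by have := max_card (pred1 (x 1%g)); rewrite A0 card1.
  rewrite ln0// pmulr_lle0// ltr0n cardfs_gt0//.
set h := entropy_rate R X in h0.
have few n : (npat (F n) X <= #|` K| * #|` F n| *
    (#|A| ^ (#|` shell S r (F n)| + #|` K|) * (N0 * #|` F n| ^ 2)))%N.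
  apply: npat_few_exchanges => // q Xq; apply: contrapT => many.
  apply: none; exists (F n), q; split => // g.
  by rewrite leqNgt; apply/negP => lt; apply: many; exists g.
pose C := (#|` K| * #|A| ^ #|` K| * N0)%N.
have C0 : (0 < C)%N by rewrite !muln_gt0 cardfs_gt0 K0 expn_gt0 A0.
pose B := #|` fset_set (word_ball S r)|.
(* Each of three errors gets a quarter of h |F n|: [d] serves 3 ln |F n|, [e] the boundary and [m]
   the constants. *)
pose d := h / 12.
have d0 : 0 < d by rewrite /d divr_gt0.
pose L := ln #|A|%:R : R.
have L0 : 0 <= L by rewrite ln_ge0// ler1n.
pose e := h / (4 * (B%:R * L + 1)).
have BL0 : 0 <= B%:R * L by rewrite mulr_ge0.
have e0 : 0 < e by rewrite /e divr_gt0// mulr_gt0// ltr_wpDl.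
pose m := (Num.truncn ((ln C%:R - 3 * ln d) * 4 / h)).+1.
have [n [bn mn]] := filter_ex (filterI (folner_bnd r FF e0) (folner_card m Ginf FF)).
have Fn : (0 < #|` F n|)%N by rewrite cardfs_gt0.
have FnR : 0 < #|` F n|%:R :> R by rewrite ltr0n.
have few_n : (npat (F n) X <= C * #|` F n| ^ 3 *
    #|A| ^ (#|` boundary_fset S r (F n)| * B))%N.
  apply: leq_trans (few n) _; rewrite expnD.
  rewrite [leqLHS](_ : _ = C * #|` F n| ^ 3 * #|A| ^ #|` shell S r (F n)|)%N.
    by rewrite leq_mul2l leq_pexp2l ?orbT//; exact: leq_card_imfset2.
  rewrite /C (expnS _ 2); move: (#|A| ^ #|` K|)%N (#|A| ^ _)%N (#|` F n| ^ 2)%N.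
  by move=> u v w; rewrite [LHS](AC (2*(2*2)) (1*4*5*(2*6)*3)).
clearbody C.
have Xn : (0 < npat (F n) X)%N.
  rewrite lt0n; apply/eqP => X0; have := entropy_rate_le R X (F0 n).
  by rewrite -/h /pressure X0 ln0// leNgt mulr_gt0.
have := entropy_rate_le R X (F0 n); rewrite -/h /pressure.
have : ln (npat (F n) X)%:R <= ln C%:R + 3 * ln #|` F n|%:R +
    #|` boundary_fset S r (F n)|%:R * (B%:R * L) :> R.
  rewrite [leRHS](_ : _ = ln (C * #|` F n| ^ 3 *
      #|A| ^ (#|` boundary_fset S r (F n)| * B))%:R).
    rewrite ler_ln ?ler_nat// posrE ltr0n//.
    by rewrite 2!muln_gt0 !expn_gt0 C0 Fn A0.
  rewrite !natrM !natrX !lnM ?posrE ?mulr_gt0 ?exprn_gt0 ?ltr0n//.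
  by rewrite !lnXn ?ltr0n// -/L -[L *+ _]mulr_natl natrM; ring.
have := ln_le_scale FnR d0.
have : #|` boundary_fset S r (F n)|%:R * (B%:R * L) <= h / 4 * #|` F n|%:R :> R.
  apply: le_trans (ler_wpM2r BL0 bn) _.
  rewrite mulrAC ler_pM2r//; set D := B%:R * L.
  have D1 : 0 < D + 1 by rewrite ltr_wpDl.
  rewrite (_ : e * D = h / 4 * (D / (D + 1))); last first.
    by rewrite /e -/D; field; rewrite gt_eqF.
  by rewrite ler_piMr ?divr_ge0 ?ltW// ltr_pdivrMr// mul1r ltrDl.
have : (ln C%:R - 3 * ln d) < h / 4 * #|` F n|%:R.
  have : (ln C%:R - 3 * ln d) * 4 / h < #|` F n|%:R.
    apply: lt_le_trans (_ : m%:R <= _); last by rewrite ler_nat.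
    exact: truncnS_gt.
  rewrite ltr_pdivrMr// => lt.
  rewrite -(ltr_pM2r (_ : 0 < 4 :> R))//; apply: lt_le_trans lt _.
  by rewrite mulrAC divfK// mulrC.
rewrite /d; have : 0 < h * #|` F n|%:R by rewrite mulr_gt0.
set hF := h * #|` F n|%:R.
rewrite [h / 12 * _]mulrAC [h / 4 * _]mulrAC -/hF.
lra.
Qed.

End many_exchanges.

(** * Shifts of finite type are not isolated *)

Section non_isolation.
Variables (R : realType) (G : groupType) (A : finType) (S : {fset G}).
Hypothesis S_generates : generates S.
Hypothesis G_infinite : infinite_set [set: G].
Hypothesis G_amenable : amenable S R.
Local Notation cfg := (configuration G A).
Implicit Types (K E F W : {fset G}) (X Z : set cfg) (x y q : cfg) (g h : G).

Section sft.
Variables (r : nat) (K F : {fset G}) (X : set cfg) (q : cfg) (N : nat).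
Hypothesis Kr : forall k, k \in K -> word_ball S r k.
Hypothesis sX : is_shift X.
Hypothesis hX : sft_hull K X `<=` X.
Hypothesis F0 : F != fset0.
Hypothesis N_exchanges : forall g, (N <= npat F (exchanges S X r F K q g))%N.
Hypothesis N_large : (4 * #|` F| ^ 2 <= N)%N.

Let Y := avoid_all X F q.
Let a : R := 1 - 2 / N%:R.

Let a_gt0 : 0 < a.
Proof.
have F1 : (0 < #|` F|)%N by rewrite cardfs_gt0.
have N4 : (4 <= N)%N.
  by apply: leq_trans N_large; rewrite leq_pmulr// expn_gt0 F1.
have NR : 0 < N%:R :> R by rewrite ltr0n (leq_trans _ N4).
rewrite subr_gt0 ltr_pdivrMr// mul1r.
by apply: lt_le_trans (_ : 4%:R <= _); rewrite ?ltr_nat ?ler_nat.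
Qed.

Let a_le1 : a <= 1.
Proof. by rewrite gerBl divr_ge0. Qed.

(** With the content of [K] prescribed, some point avoids [q] at any given finite set of sites;
    compactness yields a point of [Y]. *)
Lemma patterns_avoid_all : patterns K Y = patterns K X.
Proof.
apply/eqP; rewrite finset.eqEsubset patterns_sub/=; last by move=> x [].
apply/fintype.subsetP => _ /patternsP[p Xp <-].
have [||x [Yx xp]] :=
  @avoid_limit _ _ X F q [set x | restrict K x = restrict K p] K sX.
- by move=> x y /= <-.
- move=> W; pose F' := [fset (g * f)%g | g in W, f in F]%fset.
  have WF g f : g \in W -> f \in F -> (g * f)%g \in F'.
    by move=> gW fF; apply/imfset2P; exists g => //; exists f.
  have := npat_avoid S_generates R Kr sX.2 hX N_exchanges F0 N_large p WF.
  have : 0 < a ^+ #|` W| * (npat F' [set x | X x /\ restrict K x = restrict K p])%:R.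
    rewrite mulr_gt0 ?exprn_gt0// ltr0n; apply/npat_gt0; by exists p.
  move=> /lt_le_trans h {}/h; rewrite ltr0n => /npat_gt0[x [[Xx xp] xW]].
  by exists x.
by apply/patternsP; exists x.
Qed.

(** Were every finite [W] insufficient, a limit would be a point of [Y] whose content on [E] is
    foreign to [Y]. *)
Lemma avoid_all_extend E : exists W, forall x, avoid X F q W x ->
  restrict E x \in patterns E Y.
Proof.
apply: contrapT => h.
have [||x [Yx]] :=
  @avoid_limit _ _ X F q [set x | restrict E x \notin patterns E Y] E sX.
- by move=> x y /= ->.
- move=> W; apply: contrapT => h'; apply: h; exists W => x xW.
  by apply: contrapT => /negP xE; apply: h'; exists x.
by rewrite /= mem_patterns.
Qed.

(** Points avoiding [q] inside a Følner set are counted in two ways: [npat_avoid] bounds their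
    number below, losing at most -ln a per site, and a covering by translates of [E], which deep
    inside show only patterns of [Y], bounds it above. *)
Lemma pressure_avoid_all E : X !=set0 -> E != fset0 ->
  (entropy_rate R X + ln a) * #|` E|%:R <= pressure R E Y.
Proof.
move=> X0 E0; have [W WE] := avoid_all_extend E.
have [Fn FF] := G_amenable; have [Fn0 _] := FF.
(* A translate of this ball inside [Fn n] forces the corresponding translate of [W] into [D]. *)
have [rho' rhoP] := sub_word_ball S (E `|` [fset (w * f)%g | w in W, f in F])%fset.
have [f0 f0F] : exists f, f \in F by apply/fset0Pn.
have Y0 : Y !=set0.
  by apply/(npat_gt0 K); rewrite /npat patterns_avoid_all; apply/npat_gt0.
rewrite mulrC; apply: (folner_le (C := #|` E|%:R * ln #|A|%:R) (r := rho') FF) => n.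
pose D := [fset g in [fset (h * f0^-1)%g | h in Fn n] |
  [forall f : F, (g * val f)%g \in Fn n]]%fset.
have DP g : reflect (forall f, f \in F -> (g * f)%g \in Fn n) (g \in D).
  rewrite !inE; apply: (iffP andP) => [[_ /forallP gF] f fF|gF].
    exact: (gF (FSetSub fF)).
  split; last by apply/forallP => f; apply: gF; exact: valP.
  by apply/imfsetP; exists (g * f0)%g => /=; [exact: gF|rewrite mulgK].
have DF : (#|` D| <= #|` Fn n|)%N.
  apply: (@leq_trans #|` [fset (h * f0^-1)%g | h in Fn n]%fset|).
    by apply: fsubset_leq_card; apply/fsubsetP => g; rewrite !inE => /andP[].
  exact: leq_imfset_card.
(* Here no pattern has to be kept, so the prescribed window is empty. *)
have XE : [set x | X x /\ restrict fset0 x = restrict fset0 q] = X.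
  by apply/seteqP; split=> [x []//|x Xx]; split => //; exact/restrictP.
have N_exchanges0 g : (N <= npat F (exchanges S X r F fset0 q g))%N.
  apply: leq_trans (N_exchanges g) _; apply: npatS => // y [Xy /restrictP yq].
  split => //; apply/restrictP => h; rewrite /frozen inE => /orP[hs|].
    by apply: yq; rewrite /frozen inE hs.
  by rewrite inE in_translate inE.
have := npat_avoid S_generates R Kr sX.2 hX N_exchanges0 F0 N_large q
  (fun g f gD fF => elimT (DP g) gD f fF).
rewrite XE -/a => low.
set Z := avoid X F q D in low.
have nX : (0 < npat (Fn n) X)%N by apply/npat_gt0.
have nXR : 0 < (npat (Fn n) X)%:R :> R by rewrite ltr0n.
have nZR : 0 < (npat (Fn n) Z)%:R :> R.
  by apply: lt_le_trans low; rewrite mulr_gt0// exprn_gt0.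
have nZ : Z !=set0 by apply/(npat_gt0 (Fn n)); rewrite -(ltr0n R).
have lowp : #|` Fn n|%:R * (entropy_rate R X + ln a) <= pressure R (Fn n) Z.
  apply: (@le_trans _ _ (ln (a ^+ #|` Fn n| * (npat (Fn n) X)%:R))).
    rewrite lnM ?posrE ?exprn_gt0// lnXn// -[ln a *+ _]mulr_natl mulrDr addrC lerD2l.
    by rewrite mulrC; exact: entropy_rate_le.
  rewrite ler_ln ?posrE ?mulr_gt0 ?exprn_gt0//; apply: le_trans low.
  by rewrite ler_wpM2r// ler_wiXn2l// ltW.
have cov := @npat_covering_ln R _ _ S S_generates rho' E (Fn n) Z (npat E Y) E0.
rewrite [_ * #|` Fn n|%:R]mulrC mulrCA.
apply: le_trans (_ : #|` E|%:R * pressure R (Fn n) Z <= _).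
  by rewrite ler_wpM2l.
rewrite [pressure R E Y * _]mulrC; apply: cov => //.
- by move=> k kE; apply: rhoP; rewrite inE kE.
- exact/npat_gt0.
move=> g gF; apply: (@leq_trans (npat E (avoid X F q W))).
  apply: npat_translate => x [Xx xD]; split; first exact: sX.2.
  move=> w wW /occursP xw; apply: (xD (g * w)%g).
    apply/DP => f fF; rewrite -mulgA; apply: gF; apply: rhoP.
    by rewrite inE; apply/orP; right; apply/imfset2P; exists w => //; exists f.
  by apply/occursP => f /xw; rewrite /shift_act invgK mulgA.
apply: subset_leq_card; apply/fintype.subsetP => _ /patternsP[x xW <-].
exact: WE.
Qed.

End sft.

Lemma sft_not_isolated K X (c : R) : is_shift X -> X !=set0 ->
    sft_hull K X `<=` X -> 0 <= c -> c < entropy_rate R X ->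
  exists Y, [/\ is_shift Y, Y <> X, patterns K Y = patterns K X &
    (c%:E <= entropy R S Y)%E].
Proof.
move=> sX X0 hX c0 cX.
wlog K0 : K hX / K != fset0.
  move=> wl; have [] := wl (1%g |` K)%fset.
  - move=> x xK; apply: hX => g; have := xK g.
    move=> /patternsP[y Xy /restrictP yx]; apply/patternsP; exists y => //.
    by apply/restrictP => k kK; apply: yx; rewrite inE kK orbT.
  - by apply/fset0Pn; exists 1%g; exact: fset1U1.
  move=> Y [sY YX YK cY]; exists Y; split => //.
  by apply: patterns_eqS YK; exact: fsubsetU1.
have [r Kr] := sub_word_ball S K.
(* The bound 2/N <= e says that the loss -ln (1 - 2/N) is at most the gap between the entropy of [X]
   and [c]; the 4 in [N0] serves the local lemma. *)
pose e := 1 - expR (c - entropy_rate R X).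
have e0 : 0 < e by rewrite subr_gt0 expR_lt1 subr_lt0.
pose N0 := (maxn 4 (Num.truncn (2 / e)).+1).
have N04 : (4 <= N0)%N by exact: leq_maxl.
have [F [q [F0 Xq Nq]]] := exists_exchanges S_generates r G_infinite G_amenable K0
  (leq_trans (isT : 0 < 4)%N N04) (le_lt_trans c0 cX).
set N := (N0 * #|` F| ^ 2)%N in Nq.
have F1 : (0 < #|` F| ^ 2)%N by rewrite expn_gt0 cardfs_gt0 F0.
have N4 : (4 * #|` F| ^ 2 <= N)%N by rewrite leq_mul2r N04 orbT.
have N0N : (N0 <= N)%N by rewrite leq_pmulr.
have NR : 0 < N%:R :> R by rewrite ltr0n (leq_trans _ N0N)// (leq_trans _ N04).
have cln : c <= entropy_rate R X + ln (1 - 2 / N%:R).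
  rewrite -lerBlDl -[leLHS]expRK ler_ln ?posrE ?expR_gt0//.
    rewrite lerBrDr -lerBrDl -/e ler_pdivrMr// mulrC -ler_pdivrMr//.
    apply: le_trans (_ : N0%:R <= _); last by rewrite ler_nat.
    apply: le_trans (_ : (Num.truncn (2 / e)).+1%:R <= _).
      exact/ltW/truncnS_gt.
    by rewrite ler_nat leq_maxr.
  rewrite subr_gt0 ltr_pdivrMr// mul1r.
  apply: lt_le_trans (_ : 4%:R <= _); first by rewrite ltr_nat.
  by rewrite ler_nat (leq_trans N04).
pose Y := avoid_all X F q.
have sY : is_shift Y by exact: avoid_all_shift.
have YK : patterns K Y = patterns K X := patterns_avoid_all Kr sX hX F0 Nq N4.
(* The point [q] of [X] is not in [Y], since [q] occurs in itself at the identity. *)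
exists Y; split => //.
  move=> YX; have : Y q by rewrite YX.
  by move=> [_ /(_ 1%g)]; apply; rewrite /occurs invg1 shift_act1.
apply/entropy_geP => //; first exact: sY.2.
split; first by apply/(npat_gt0 K); rewrite /npat YK; apply/npat_gt0.
move=> E E0; apply: le_trans (pressure_avoid_all Kr sX hX F0 Nq N4 X0 E0).
by rewrite ler_wpM2r.
Qed.

End non_isolation.

(** Over a finite group the space of shifts would be finite and discrete. For [c] above ln |A| the
    set of shifts is empty, so the homeomorphism is claimed up to ln |A|. *)
Theorem corollary1p10 (R : realType) (G : groupType) (A : finType)
    (S : {fset G}) (G_countable : countable [set: G])
    (G_infinite : infinite_set [set: G])
    (S_generates : generates S) (G_amenable : amenable S R) :
  exists2 D : set R, countable D &
    forall c : R, 0 <= c -> ~ D c ->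
      isolated (entropy_ge A S c) = set0 /\
      (c <= ln #|A|%:R -> homeomorphic (entropy_ge A S c) cantor_space).
Proof.
pose B n : {fset G} := fset_set (word_ball S n).
pose sft n (P : {set {ffun B n -> A}}) : set (configuration G A) :=
  [set x | forall g, restrict (B n) (shift_act g x) \in P].
(* Each ball carries finitely many sets of patterns. Including 0 makes [c] positive, so that
   [c <= ln #|A|] excludes an empty alphabet, for which [ln] gives 0. *)
exists (\bigcup_n ([set 0] `|` range (fun P => entropy_rate R (@sft n P)))).
  apply: bigcup_countable => // n _; apply: finite_set_countable.
  by rewrite finite_setU; split; last exact: finite_image.
move=> c c0 Dc.
have c_gt0 : 0 < c.
  by rewrite lt_neqAle c0 andbT; apply/eqP => c1; apply: Dc; exists 0%N => //; left.
have iso0 : isolated (entropy_ge A S c) = set0.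
  apply/seteqP; split=> // X [/set_mem Xc [V /nbhs_shiftP[K KV] VX]].
  have sX : is_shift (set_val X) := set_valP X.
  have [n Kn] := sub_word_ball S K.
  have KB : (K `<=` B n)%fset.
    apply/fsubsetP => k /Kn kn; rewrite in_fset_set ?inE//.
    exact: finite_word_ball.
  (* Isolation of [X], its window enlarged to a ball so that the hull is among the shifts used in
     the exceptional set. *)
  have uniq Y : is_shift Y -> patterns (B n) Y = patterns (B n) (set_val X) ->
      (c%:E <= entropy R S Y)%E -> Y = set_val X.
    move=> sY YX cY; pose Y1 : shift_space G A := SigSub (mem_set sY).
    suff <- : Y1 = X by [].
    rewrite -[Y1 = X]/([set X] Y1) -VX; split => //.
    by apply: KV; exact: patterns_eqS KB YX.
  have [X0 cX] := (entropy_geP S_generates G_amenable c sX.2).1 Xc.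
  (* The hull contains [X] and looks like [X] on [B n], so isolation forces
     [X] to be of finite type. *)
  have hull : sft_hull (B n) (set_val X) = set_val X.
    apply: uniq; [exact: sft_hull_shift|exact/patterns_sft_hull/sX.2|].
    apply/entropy_geP => //; first exact: (sft_hull_shift _ _).2.
    have sub := sub_sft_hull (B n) sX.2.
    split; first by have [x Xx] := X0; exists x; exact: sub.
    move=> E /cX /le_trans; apply; rewrite ler_ln ?posrE ?ltr0n ?npat_gt0//.
      by rewrite ler_nat; exact: npatS.
    by have [x Xx] := X0; exists x; exact: sub.
  have cle : c <= entropy_rate R (set_val X) by exact: entropy_rate_ge.
  have clt : c < entropy_rate R (set_val X).
    (* Equality would make [c] the entropy of a shift of finite type. *)
    rewrite lt_neqAle cle andbT; apply/eqP => cE; apply: Dc.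
    exists n => //; right; exists (patterns (B n) (set_val X)) => //.
    by rewrite -[in RHS]hull in cE *; rewrite cE.
  have hs : sft_hull (B n) (set_val X) `<=` set_val X by rewrite hull.
  have [Y [sY YX YB cY]] :=
    sft_not_isolated S_generates G_infinite G_amenable sX X0 hs c0 clt.
  by apply: YX; exact: uniq.
split => // cA; apply: entropy_ge_homeomorphic => //.
have A0 : (0 < #|A|)%N.
  by rewrite lt0n; apply/eqP => A0; move: cA; rewrite A0 ln0// leNgt c_gt0.
have /card_gt0P[a0 _] := A0.
have sT : is_shift [set: configuration G A] by split; first exact: closedT.
(* The full shift, whose entropy is ln |A|, shows that the space is nonempty. *)
exists (SigSub (mem_set sT)).
apply/(entropy_geP S_generates G_amenable c sT.2).
split; first by exists (fun=> a0).
move=> K K0; rewrite /pressure /npat /= (_ : patterns _ _ = finset.setT).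
  rewrite cardsT card_ffun -cardfE natrX lnXn ?ltr0n//.
  by rewrite -[leRHS]mulr_natr ler_wpM2r.
apply/setP => p; rewrite [RHS]inE; apply/patternsP.
exists (fun h => if pselect (h \in K) is left hK then p (FSetSub hK) else a0) => //.
apply/ffunP => k; rewrite ffunE; case: pselect => [kK|[]]; last exact: valP.
by congr (p _); exact: val_inj.
Qed.
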